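(* Let $b$ be a non-negative integer and let $r$ be a positive integer with $r>b$. When $\beta=(b)$ and $\kappa=(r)$, the bounds $m\ge r-b+[b\ge1]$ and $n\ge r+\beta_1$ in the following two theorems (in the first as the range in which the plethysm coefficient is constant with the stated value, in the second as the hypothesis for the stated equality) cannot be weakened. Theorem A. Let $\beta\vdash b$ and $\kappa\vdash r$ be partitions such that $\beta[n]$ and $\kappa[mn]$ are also partitions. The plethysm coefficient $p(\beta[n],(m),\kappa[mn])$ is constant for $m\ge r-|\beta|+[\beta\ne\varnothing]$ and $n\ge r+\beta_1$, and its value is $$\sum c^\beta_{\beta^p,\ldots,\beta^1}\Bigl[\Bigl(\bigl(\bigotimes_{i=1}^{p}\mathrm{Inf}_{\mathfrak S_{c_i}}^{\mathfrak S_i\wr\mathfrak S_{c_i}}\mathbf S^{\beta^i}\bigr)\big\uparrow^{\mathfrak S_p}\otimes\,\mathbb C_{\mathrm{Stab}(\epsilon)}\big\uparrow^{\mathfrak S_q}\Bigr)\Big\uparrow^{\mathfrak S_r}:\mathbf S^\kappa\Bigr]_{\mathfrak S_r},$$ where the sum is over all $p,q$ with $p+q=r$, all partitions $\gamma=(p^{c_p},\ldots,1^{c_1})\vdash p$ with exactly $b$ parts, all sequences of partitions $\beta^i\vdash c_i$ for $1\le i\le p$, and all partitions $\epsilon$ of $q$ with no part equal to $1$. Theorem C (equality part). Let $\beta,\kappa$ be partitions such that $\beta[n]$ and $\kappa[mn]$ are also partitions, and suppose $r\ge|\kappa|$. If $m\ge r-|\beta|+[\beta\ne\varnothing]$ and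 $n\ge r+\beta_1$, then $$p(\beta[n],(m),\kappa[mn])=\bigl[\Delta_r(\varnothing^\beta)\big\downarrow^{R_r(m,n)}_{P_r(mn)}:L_r(\kappa)\bigr]_{P_r(mn)}.$$
   Context: For partitions $\nu\vdash n$, $\mu\vdash m$, $\lambda\vdash mn$, the plethysm coefficient $p(\nu,\mu,\lambda)=\langle s_\nu\circ s_\mu,s_\lambda\rangle$ is the multiplicity of the Schur function $s_\lambda$ in the plethysm $s_\nu\circ s_\mu$. For a partition $\alpha$, $\alpha[d]=(d-|\alpha|,\alpha_1,\alpha_2,\dots)$; thus for $\beta=(b)$ and $\kappa=(r)$ the coefficient concerned is $p\bigl((n-b,b),(m),(mn-r,r)\bigr)$. If $b=0$ then $(b)$ means $\varnothing$ and $\beta_1=0$. The bracket $[\,\cdot\,]$ around a condition is $1$ if the condition holds and $0$ otherwise. $\mathbf S^\lambda$ is the irreducible right $\mathbb C\mathfrak S_n$-module (Specht module) labelled by $\lambda\vdash n$; $[M:L]$ denotes the multiplicity of a simple module $L$ in $M$. $\mathrm{Inf}$ is inflation along $\mathfrak S_i\wr\mathfrak S_{c_i}\to\mathfrak S_{c_i}$; $\uparrow$ is induction (from $\prod_i\mathfrak S_i\wr\mathfrak S_{c_i}$ to $\mathfrak S_p$, from $\mathrm{Stab}(\epsilon)$ to $\mathfrak S_q$, and from $\mathfrak S_p\times\mathfrak S_q$ to $\mathfrak S_r$). $c^\beta_{\beta^p,\dots,\beta^1}$ is the multiplicity of $\mathbf S^{\beta^p}\otimes\cdots\otimes\mathbf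 S^{\beta^1}$ in the restriction of $\mathbf S^\beta$ to $\mathfrak S_{c_p}\times\cdots\times\mathfrak S_{c_1}$. $\mathrm{Stab}(\epsilon)\le\mathfrak S_q$ is the stabiliser of a set-partition of $\{1,\dots,q\}$ into parts of sizes $\epsilon_1,\epsilon_2,\dots$, and $\mathbb C_{\mathrm{Stab}(\epsilon)}$ is its trivial module. Partition algebra. An $(r,s)$-set-partition is a set-partition of the northern vertices $1,\dots,r$ together with the southern vertices $\bar1,\dots,\bar s$; its parts are blocks, and a block is propagating if it contains both northern and southern vertices. Stacking an $(r,s)$-set-partition above an $(s,t)$-set-partition means identifying the southern vertices of the first with the northern vertices of the second, taking connected components, and deleting the components consisting only of middle vertices. $P_r(\delta)$ is the $\mathbb C$-algebra with basis the $(r,r)$-set-partitions and product given by stacking, multiplied by $\delta$ for each deleted component. For $0\le k\le r$, $V_r(k)$ has basis the $(k,r)$-set-partitions with exactly $k$ propagating blocks, with left action of $\mathfrak S_k$ (permuting northern vertices) and right action of $P_r(\delta)$ by stacking below with the same scalars, results with fewer than $k$ propagating blocks being set to $0$. For $\kappa\vdash k\le r$ and $\delta\neq0$, $L_r(\kappa)$ is the simple head of the standard module $\Delta_r(\kappa)=\mathbf S^\kappa\otimes_{\mathbb C\mathfrak S_k}V_r(k)$. Ramified partition algebra. A ramified $(r,s)$-set-partition is a pair $(\Lambda,\Lambda')$ of $(r,s)$-set-partitions such that every block of $\Lambda$ (inner block) is contained in a block of $\Lambda'$ (outer block). $R_r(m,n)$ is the $\mathbb C$-algebra with basis the ramified $(r,r)$-set-partitions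 and product given by stacking inner and outer set-partitions separately, multiplied by $m$ for each deleted inner component and $n$ for each deleted outer component. The span of the pairs $(\Lambda,\Lambda)$ is a subalgebra identified with $P_r(mn)$; $\downarrow$ denotes restriction to it. $V_r(0^b)$ has basis the ramified $(b,r)$-set-partitions in which each northern vertex is a singleton inner block and lies in an outer block containing at least one southern vertex and no other northern vertex; $\mathfrak S_b$ acts on the left by permuting northern vertices, and $R_r(m,n)$ acts on the right by stacking below with the scalars just described, results not in this basis being set to $0$. For $\beta\vdash b\le r$, $\Delta_r(\varnothing^\beta)=\mathbf S^\beta\otimes_{\mathbb C\mathfrak S_b}V_r(0^b)$. *)

(* Defs.v *)
From HB Require Import structures.
From mathcomp Require Import all_boot all_fingroup all_algebra.
From mathcomp Require Import mxrepresentation.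
From mathcomp.real_closed Require Import mxtens complex.
From mathcomp Require Import boolp reals mpoly.
From mathcomp Require classical_sets.

Set Implicit Arguments.
Unset Strict Implicit.
Unset Printing Implicit Defensive.

Import GRing.Theory.

Definition is_partition_of (n : nat) (l : seq nat) : bool :=
  [&& sorted geq l, 0 \notin l & sumn l == n].

Definition intpartn (n : nat) :=
  {l : n.-bseq 'I_n.+1 | is_partition_of n (map val l)}.

Definition parts n (l : intpartn n) : seq nat := map val (val l).
Coercion parts : intpartn >-> seq.

(* The one-row partition (b), which is the empty partition when b = 0. *)
Definition row_partition (b : nat) : seq nat := if b == 0 then [::] else [:: b].

(* alpha[d] = (d - |alpha|, alpha_1, alpha_2, ...), with zero parts dropped so
   that it is in the normal form required by [is_partition_of]; whether the
   untruncated sequence is a partition is [pad_is_partition]. *)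
Definition pad (al : seq nat) (d : nat) : seq nat :=
  [seq x <- (d - sumn al) :: al | x != 0].
Definition pad_is_partition (al : seq nat) (d : nat) : bool :=
  (sumn al <= d) && sorted geq ((d - sumn al) :: al).

(* The cell (i, j) of the Young diagram of [la], rows and columns from 0. *)
Definition cell (la : seq nat) := {i : 'I_(size la) & 'I_(nth 0 la i)}.

Definition is_ssyt la K (t : {ffun cell la -> 'I_K}) : bool :=
  [forall x : cell la, forall y : cell la,
     ((tag x == tag y) && (tagged x <= tagged y)%N ==> (t x <= t y)%N)
  && ((tag x < tag y)%N && (tagged x == tagged y :> nat) ==> (t x < t y)%N)].

Definition ssyt la K := {t : {ffun cell la -> 'I_K} | is_ssyt t}.

Section Schur.
Local Open Scope ring_scope.

Definition tab_weight (A : comNzRingType) la K (x : 'I_K -> A) (t : ssyt la K) : A :=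
  \prod_(u : cell la) x (val t u).

Definition schur (A : comNzRingType) la K (x : 'I_K -> A) : A :=
  \sum_(t : ssyt la K) tab_weight x t.

Definition var N (i : 'I_N) : {mpoly int[N]} := 'X_i.

(* (s_nu o s_mu)(x_0, ..., x_(N-1)): s_nu evaluated at the monomials of s_mu,
   each one taken as often as it occurs in s_mu. *)
Definition schur_plethysm nu mu N : {mpoly int[N]} :=
  schur nu (fun j : 'I_#|{: ssyt mu N}| => tab_weight (@var N) (enum_val j)).

(* <s_nu o s_mu, s_la> = k: in the expansion of s_nu o s_mu in Schur functions,
   s_la has coefficient k.  The plethysm is homogeneous of degree
   N = |nu| |mu|; in that degree, setting all but the first N variables to 0 is
   an isomorphism from symmetric functions onto symmetric polynomials in N
   variables, and the Schur polynomials of the partitions of N are a basis. *)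
Definition plethysm_coef_is nu mu la (k : int) : Prop :=
  let N := (sumn nu * sumn mu)%N in
  exists2 c : intpartn N -> int,
    schur_plethysm nu mu N = \sum_(ta : intpartn N) schur ta (@var N) *~ c ta
  & exists2 ta : intpartn N, ta = la :> seq nat & c ta = k.

End Schur.

Section Modules.
Local Open Scope ring_scope.
Variable F : fieldType.

(* A right module over an F-algebra (for instance a group algebra) spanned by
   a family of elements indexed by D, given by the matrices of these elements
   acting on row vectors.  Submodules, homomorphisms and composition factors
   depend only on these matrices. *)
Record rmod (D : Type) := RMod { rdim : nat; ract : D -> 'M[F]_rdim }.

Section Theory.
Variable D : Type.
Implicit Types M L : rmod D.

Definition submodule M (U : 'M[F]_(rdim M)) : Prop :=
  forall a, (U *m ract M a <= U)%MS.

Definition sub_rmod M (U : 'M[F]_(rdim M)) : rmod D :=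
  RMod (fun a => in_submod U (val_submod (1%:M : 'M_(\rank U)) *m ract M a)).

Definition quot_rmod M (U : 'M[F]_(rdim M)) : rmod D :=
  RMod (fun a =>
    in_factmod U (val_factmod (1%:M : 'M_(\rank (cokermx U))) *m ract M a)).

Definition simple_rmod M : Prop :=
  (0 < rdim M)%N /\
  forall U : 'M[F]_(rdim M), submodule U -> U = 0 \/ row_full U.

Definition iso_rmod M L : Prop :=
  rdim M = rdim L /\
  exists2 f : 'M[F]_(rdim M, rdim L),
    row_free f & forall a, ract M a *m f = f *m ract L a.

(* [comp_mult L M k]: M has a composition series with exactly k factors
   isomorphic to L.  The series is built from the bottom: a simple submodule U
   of M, followed by a composition series of M / U. *)
Inductive comp_mult L : rmod D -> nat -> Prop :=
| CompMult0 M : rdim M = 0%N -> comp_mult L M 0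
| CompMultS M (U : 'M[F]_(rdim M)) k :
    submodule U -> simple_rmod (sub_rmod U) -> comp_mult L (quot_rmod U) k ->
    comp_mult L M (`[< iso_rmod (sub_rmod U) L >] + k)%N.

(* [M : L], independent of the composition series by Jordan-Hoelder. *)
Definition mult M L : nat := classical_sets.xget 0%N (comp_mult L M).

Definition maximal_submodule M (W : 'M[F]_(rdim M)) : Prop :=
  [/\ submodule W, ~~ row_full W
    & forall U : 'M[F]_(rdim M), submodule U -> (W <= U)%MS ->
        (U <= W)%MS \/ row_full U].

(* The intersection of all maximal submodules. *)
Definition radical M : 'M[F]_(rdim M) :=
  classical_sets.xget 0 (fun U : 'M[F]_(rdim M) =>
    forall X : 'M[F]_(rdim M),
      (X <= U)%MS <-> (forall W, maximal_submodule W -> (X <= W)%MS)).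

Definition head_rmod M : rmod D := quot_rmod (radical M).

End Theory.

(* Restriction along a map (subalgebra or subgroup inclusion, or, for
   inflation, a group quotient). *)
Definition pull_rmod (D D' : Type) (f : D' -> D) (M : rmod D) : rmod D' :=
  RMod (fun a => ract M (f a)).

Definition triv_rmod (D : Type) : rmod D := RMod (fun _ => 1%:M : 'M_1).

(* M (x) N with group elements acting diagonally. *)
Definition tens_rmod (D : Type) (M N : rmod D) : rmod D :=
  RMod (fun a => ract M a *t ract N a).

(* The endomorphism of the space with basis A sending the basis element x to
   w x times f x, or to 0 when f x is not in A. *)
Definition monomial_mx (T : finType) (A : {set T}) (f : T -> T) (w : T -> F) :
    'M[F]_#|A| :=
  \matrix_(i, j) (if f (enum_val i) == enum_val j then w (enum_val i) else 0).

(* M (x)_{FH} V, for a right FH-module M and a bimodule V on which H acts on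
   the left by [la] and D on the right by [ra].  M (x) V is the space of
   matrices, with v (x) w the matrix v^T *m w; the quotient is by the span of
   all (v h) (x) w - v (x) (h w). *)
Section BalancedTensor.
Variables (H : finType) (D : Type) (d : nat).
Variables (M : rmod H) (la : H -> 'M[F]_d) (ra : D -> 'M[F]_d).

Definition free_tensor : rmod D :=
  RMod (fun a => lin_mulmxr (ra a) : 'M_(rdim M * d)).

Definition balancing : 'M[F]_(rdim M * d) :=
  (\sum_(h : H) (lin_mulmx ((ract M h)^T) - lin_mulmxr (la h)))%MS.

Definition balanced_tensor : rmod D :=
  quot_rmod (balancing : 'M[F]_(rdim free_tensor)).
End BalancedTensor.

Definition induce (H : finType) (gT : finGroupType) (f : H -> gT) (M : rmod H) :
    rmod gT :=
  balanced_tensor M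
    (fun h => monomial_mx [set: gT] (fun x => (f h * x)%g) (fun=> 1))
    (fun g => monomial_mx [set: gT] (fun x => (x * g)%g) (fun=> 1)).

(* The Specht module S^la of the symmetric group of a finite set T with
   |T| = |la|.  The tableau t with entries the elements of T, in the order of
   their enumeration along the successive rows, determines the row and column
   of each x : T.  The permutation module on tabloids is identified with the
   right ideal of F[Sym T] generated by the sum of the row stabiliser of t; the
   polytabloid of t is then the sum below. *)
Section Specht.
Variables (la : seq nat) (T : finType).

Definition tab_row (x : T) : nat := reshape_index la (enum_rank x).
Definition tab_col (x : T) : nat := reshape_offset la (enum_rank x).

Definition row_stab : {set {perm T}} :=
  [set s : {perm T} | [forall x, tab_row (s x) == tab_row x]].
Definition col_stab : {set {perm T}} :=
  [set s : {perm T} | [forall x, tab_col (s x) == tab_col x]].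

Definition polytabloid : 'rV[F]_#|[set: {perm T}]%G| :=
  \sum_(u in row_stab) \sum_(v in col_stab)
    (-1) ^+ odd_perm v *: delta_mx 0 (gring_index [set: {perm T}]%G (u * v)%g).

Definition specht : rmod {perm T} :=
  RMod (submod_repr (cyclic_mx_module
          (regular_repr F [set: {perm T}]%G) polytabloid)).
End Specht.

End Modules.

(* The permutation x |-> f x (only used when f is a bijection). *)
Definition perm_of_fun (T : finType) (f : T -> T) : {perm T} :=
  insubd (1%g : {perm T}) (finfun f).

Section StableValue.
Variable F : fieldType.

(* Below, gamma = (p^{c_p}, ..., 1^{c_1}) is given by p and c, where [c i] is
   the number of parts equal to i.+1.  The symmetric groups S_b, S_p and S_q
   are realised as the groups of all permutations of, respectively, the set of
   parts of gamma, the set of cells of gamma and the set of cells of epsilon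
   (cells being arranged in blocks corresponding to the parts); S_r is the
   group of permutations of the disjoint union of the last two sets. *)
Section Gamma.
Variables (p : nat) (c : 'I_p -> nat).

Definition gpart : finType := {i : 'I_p & 'I_(c i)}.
Definition gcell : finType := {i : 'I_p & ('I_(c i) * 'I_i.+1)%type}.

(* The product of the groups S_{c_i}, and the product of the wreath products
   S_i wr S_{c_i}; an element (s, t) of the latter sends point k of block j
   to point t j k of block s j. *)
Definition young : finType := {dffun forall i : 'I_p, {perm 'I_(c i)}}.
Definition wreath : finType :=
  {dffun forall i : 'I_p, {perm 'I_(c i)} * {ffun 'I_(c i) -> {perm 'I_i.+1}}}.

Definition young_perm (s : young) : {perm gpart} :=
  perm_of_fun (fun x : gpart =>
    Tagged (fun i : 'I_p => 'I_(c i)) (s (tag x) (tagged x))).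

Definition wreath_perm (w : wreath) : {perm gcell} :=
  perm_of_fun (fun x : gcell =>
    Tagged (fun i : 'I_p => ('I_(c i) * 'I_i.+1)%type)
      ((w (tag x)).1 (tagged x).1, (w (tag x)).2 (tagged x).1 (tagged x).2)).

Variable bs : {dffun forall i : 'I_p, intpartn (c i)}.

Definition lr_coef (be : seq nat) : nat :=
  mult (pull_rmod young_perm (specht F be gpart))
       (\big[@tens_rmod F young/triv_rmod F young]_(i < p)
          pull_rmod (fun s : young => s i) (specht F (bs i) 'I_(c i))).

Definition inflated_induced : rmod F {perm gcell} :=
  induce wreath_perm
    (\big[@tens_rmod F wreath/triv_rmod F wreath]_(i < p)
       pull_rmod (fun w : wreath => (w i).1) (specht F (bs i) 'I_(c i))).
End Gamma.

Section Epsilon.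
Variable ep : seq nat.

Definition ecell : finType := {l : 'I_(size ep) & 'I_(nth 0 ep l)}.

Definition stab_blocks : {set {perm ecell}} :=
  [set g : {perm ecell} | [forall x : ecell, forall y : ecell,
     (tag (g x) == tag (g y)) == (tag x == tag y)]].

Definition stab_type : finType := {g : {perm ecell} | g \in stab_blocks}.

Definition induced_from_stab : rmod F {perm ecell} :=
  induce (fun g : stab_type => val g) (triv_rmod F stab_type).
End Epsilon.

Definition sum_perm (X Y : finType) (g : {perm X} * {perm Y}) : {perm X + Y} :=
  perm_of_fun (fun z : X + Y =>
    match z with inl x => inl (g.1 x) | inr y => inr (g.2 y) end).

Definition outer_product (X Y : finType)
    (M : rmod F {perm X}) (N : rmod F {perm Y}) : rmod F {perm X + Y} :=
  induce (@sum_perm X Y) (tens_rmod (pull_rmod fst M) (pull_rmod snd N)).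

Definition stable_value (be ka : seq nat) : nat :=
  \sum_(p < (sumn ka).+1)
  \sum_(ga : intpartn p | size (ga : seq nat) == sumn be)
    let c (i : 'I_p) := count_mem i.+1 (ga : seq nat) in
  \sum_(bs : {dffun forall i : 'I_p, intpartn (c i)})
  \sum_(ep : intpartn (sumn ka - p) | 1 \notin (ep : seq nat))
    lr_coef bs be *
    mult (outer_product (inflated_induced bs) (induced_from_stab ep))
         (specht F ka (gcell c + ecell ep)%type).

End StableValue.

Definition setpart (T : finType) :=
  {P : {set {set T}} | partition P [set: T]}.
Arguments setpart T%_type_scope.

(* The set-partition of S into the nonempty fibres of f. *)
Definition fibre_setpart (S T : finType) (f : S -> T) : setpart S :=
  exist (fun P => partition P [set: S]) _ (preim_partitionP f [set: S]).

Section Stacking.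
Variables (A B C : finType) (P : setpart (A + B)) (Q : setpart (B + C)).

Definition emb_bottom (x : B + C) : A + B + C :=
  match x with inl u => inl (inr u) | inr u => inr u end.
Definition emb_outer (x : A + C) : A + B + C :=
  match x with inl u => inl (inl u) | inr u => inr u end.

Definition stack_edge : rel (A + B + C) := fun x y =>
  [exists u, exists v, [&& inl u == x, inl v == y
                         & pblock (val P) u == pblock (val P) v]]
  || [exists u, exists v, [&& emb_bottom u == x, emb_bottom v == y
                            & pblock (val Q) u == pblock (val Q) v]].

Definition component (x : A + B + C) : {set A + B + C} :=
  [set y | connect stack_edge x y].

Definition stack : setpart (A + C) :=
  fibre_setpart (fun x => component (emb_outer x)).

Definition deleted : nat :=
  #|[set K in [set component x | x : A + B + C]
       | K \subset [set inl (inr u) | u : B]]|.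
End Stacking.

(* (r,s)-set-partitions: northern vertices on the left, southern on the right *)
Definition diagram (r s : nat) := setpart ('I_r + 'I_s).

Definition propagating (r s : nat) (K : {set 'I_r + 'I_s}) : bool :=
  [exists i, inl i \in K] && [exists j, inr j \in K].

(* s . L, i.e. the permutation diagram joining north i to south s i, stacked
   above L *)
Definition permute_north (k r : nat) (s : {perm 'I_k}) (L : diagram k r) :
    diagram k r :=
  fibre_setpart (fun x : 'I_k + 'I_r =>
    pblock (val L) (match x with inl i => inl (s i) | inr j => inr j end)).

Definition refines r s (L L' : diagram r s) : bool :=
  [forall K in val L, [exists K' in val L', K \subset K']].

Definition ramified (r s : nat) :=
  {L : diagram r s * diagram r s | refines L.1 L.2}.

Lemma refines_refl r s (L : diagram r s) : refines L L.
Proof. by apply/'forall_implyP=> K LK; apply/exists_inP; exists K. Qed.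

Definition diag_ramified r s (L : diagram r s) : ramified r s :=
  exist (fun p : diagram r s * diagram r s => refines p.1 p.2) (L, L)
    (refines_refl L).

(* A module over P_r(delta), or over R_r(m, n), is given by the action of the
   basis of (ramified) diagrams; the parameters enter through this action.  The
   factors [w] and the sets of basis diagrams in [monomial_mx] carry the scalars
   for deleted components and the convention that results outside the basis
   are 0. *)
Section PartitionModules.
Local Open Scope ring_scope.
Variable F : fieldType.

Definition V_basis (k r : nat) : {set diagram k r} :=
  [set L : diagram k r | #|[set K in val L | propagating K]| == k].

Definition standard_module (delta : F) (r : nat) (ka : seq nat) :
    rmod F (diagram r r) :=
  balanced_tensor (specht F ka 'I_(sumn ka))
    (fun s => monomial_mx (V_basis (sumn ka) r) (permute_north s) (fun=> 1))
    (fun D => monomial_mx (V_basis (sumn ka) r) (fun L => stack L D)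
                (fun L => delta ^+ deleted L D)).

Definition simple_head (delta : F) (r : nat) (ka : seq nat) :
    rmod F (diagram r r) :=
  head_rmod (standard_module delta r ka).

Definition V0_basis (b r : nat) : {set diagram b r * diagram b r} :=
  [set L : diagram b r * diagram b r | refines L.1 L.2 &&
    [forall i : 'I_b, ([set inl i] \in val L.1) &&
      [exists K in val L.2,
         [&& inl i \in K, [exists j, inr j \in K]
           & [forall i' : 'I_b, (inl i' \in K) ==> (i' == i)]]]]].

Definition ramified_standard_module (m n : F) (r : nat) (be : seq nat) :
    rmod F (ramified r r) :=
  balanced_tensor (specht F be 'I_(sumn be))
    (fun s => monomial_mx (V0_basis (sumn be) r)
                (fun L => (permute_north s L.1, permute_north s L.2)) (fun=> 1))
    (fun D => monomial_mx (V0_basis (sumn be) r)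
                (fun L => (stack L.1 (val D).1, stack L.2 (val D).2))
                (fun L => m ^+ deleted L.1 (val D).1 * n ^+ deleted L.2 (val D).2)).

End PartitionModules.

Section Claims.
Variables (F : fieldType) (be ka : seq nat).

Definition claimA (m n : nat) : Prop :=
  pad_is_partition be n -> pad_is_partition ka (m * n) ->
  plethysm_coef_is (pad be n) (row_partition m) (pad ka (m * n))
    (stable_value F be ka).

(* The module for R_r(m, n) is restricted to P_r(mn), the span of the pairs
   (L, L). *)
Definition claimC (r m n : nat) : Prop :=
  sumn ka <= r ->
  pad_is_partition be n -> pad_is_partition ka (m * n) ->
  plethysm_coef_is (pad be n) (row_partition m) (pad ka (m * n))
    (mult (pull_rmod (@diag_ramified r r)
             (ramified_standard_module (m%:R : F) n%:R r be))
          (simple_head ((m * n)%:R : F) r ka)).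

End Claims.

(* The bounds M <= m and N <= n cannot be weakened as a sufficient condition for
   [claim m n]: whenever m0 <= m and n0 <= n is a sufficient condition, it
   implies M <= m and N <= n.  Bounds are normalised to be positive, since
   lower bounds 0 and 1 describe the same positive integers m, n. *)
Definition bounds_not_weakenable (claim : nat -> nat -> Prop) (M N : nat) : Prop :=
  forall m0 n0 : nat, 0 < m0 -> 0 < n0 ->
    (forall m n : nat, m0 <= m -> n0 <= n -> claim m n) ->
    M <= m0 /\ N <= n0.

(* Main.v *)
From mathcomp Require Import all_boot all_fingroup all_algebra.
From mathcomp Require Import mxrepresentation.
From mathcomp.real_closed Require Import complex.
From mathcomp Require Import boolp reals mpoly.
From mathcomp Require classical_sets.
From mathcomp Require Import zify ring.
Require Import Defs.

(** Both bounds fail by exactly one. In two variables, the Jacobi-Trudi formula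
    [s_(a,b) = h_a h_b - h_(a+1) h_(b-1)] makes [p((n-b,b),(m),(mn-r,r))] the
    coefficient of [X^r] in [(1 - X) (h_(n-b) h_b - h_(n-b+1) h_(b-1))] evaluated
    at [1, X, ..., X^m], where the [h_i] become Gaussian binomial coefficients.
    The two Pascal recurrences show that this coefficient is constant in the
    stated range, and drops by one both when [m] is one less than its bound and
    [n] is large, and when [n = r + b - 1] and [m] is large.

    For Theorem A this is a contradiction, since the value does not depend on
    [m] and [n]. For Theorem C, [L_r((r))] is the one-dimensional module on which
    permutation diagrams act by 1 and the other diagrams by 0, so its multiplicity
    in any module [M] is at least the dimension of [Hom(M, L_r((r)))]. For the
    restriction of [Delta_r(0^(b))] and arbitrary parameters, this space contains
    the indicator functions of the isomorphism types of basis elements whose inner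
    blocks are singletons and which have no unmarked outer block of size 1. There
    are as many types as the stable value of the plethysm coefficient, which
    therefore cannot drop. *)

Set Implicit Arguments.
Unset Strict Implicit.
Unset Printing Implicit Defensive.

Import GRing.Theory.

(** * Words and the Jacobi-Trudi formula for two rows *)

Section Multiwords.
Variable T : eqType.
Implicit Types (al u v : seq T).

(** Lists each multiset of [a] letters once, as a word following the order of [al]. The two
    recursive calls keep or discard the first letter, which is the recurrence of [h_a] in its first
    variable. *)
Fixpoint mwords (a : nat) : seq T -> seq (seq T) :=
  if a is a'.+1 then
    fix mw al := if al is y :: ys then map (cons y) (mwords a' al) ++ mw ys
                 else [::]
  else fun=> [:: [::]].

Arguments mwords : simpl never.

Lemma mwords0 al : mwords 0 al = [:: [::]]. Proof. by []. Qed.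

Lemma mwordsS a y al :
  mwords a.+1 (y :: al) = map (cons y) (mwords a (y :: al)) ++ mwords a.+1 al.
Proof. by []. Qed.

Lemma mwords_nil a : mwords a.+1 [::] = [::]. Proof. by []. Qed.

Lemma mwords_sub a al u : u \in mwords a al -> all (mem al) u.
Proof.
elim: a al u => [|a IHa] al u; first by rewrite inE => /eqP->.
elim: al u => // y al IHal u; rewrite mwordsS mem_cat.
case/orP=> [/mapP[u' /IHa u'al ->] | /IHal/allP ual].
  by rewrite /= mem_head.
by apply/allP=> x /ual /= xal; rewrite inE xal orbT.
Qed.

Lemma mwords_uniq a al : uniq al -> uniq (mwords a al).
Proof.
elim: a al => // a IHa; elim=> // y al IHal /[dup] Uyal /= /andP[y'al Ual].
rewrite mwordsS cat_uniq map_inj_uniq ?IHa ?IHal //= ?andbT; last by move=> ? ? [].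
apply/hasPn=> u /mwords_sub ual; apply/mapP=> -[u' _ Du].
by move: ual y'al; rewrite Du /= => /andP[/= ->].
Qed.

Variable e : rel T.
Hypotheses (e_total : total e) (e_trans : transitive e).

Lemma mem_mwords a al u : pairwise (fun x y => ~~ e y x) al ->
  (u \in mwords a al) = [&& size u == a, sorted e u & all (mem al) u].
Proof.
elim: a al u => [|a IHa] al u.
  by rewrite mwords0 inE => _; case: u.
elim: al u => [|y al IHal] u.
  by case: u => [|x u] //; rewrite mwords_nil /= !andbF.
move=> /[dup] Pyal; rewrite pairwise_cons => /andP[/allP lt_y Pal].
rewrite mwordsS mem_cat IHal //.
have exx x : e x x by have:= e_total x x; rewrite orbb.
have y'al: y \notin al by apply/negP=> /lt_y; rewrite exx.
case: u => [|x u].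
  by rewrite !andFb orbF; apply/negbTE/mapP=> -[].
have cons_inj (z : T) : injective (cons z) by move=> ? ? [].
rewrite /= !inE !eqSS; have [->|neq_xy] := eqVneq x y.
  rewrite mem_map // IHa // (negPf y'al) andFb !andbF orbF /=; congr (_ && _).
  case: u => //= z u; rewrite inE.
  have [->|_] := eqVneq z y; first by rewrite exx.
  case: (boolP (z \in al)) => [zal|]; last by rewrite !andbF.
  suffices ->: e y z by [].
  by have:= e_total y z; rewrite (negPf (lt_y z zal)) orbF.
have ->: (x :: u \in map (cons y) (mwords a (y :: al))) = false.
  by apply/negbTE/mapP=> -[u' _ [Dx _]]; rewrite Dx eqxx in neq_xy.
rewrite /=; case xal: (x \in al); rewrite ?andFb ?andbF //=; congr (_ && _).
apply: andb_id2l => /(order_path_min e_trans)/allP le_x.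
apply/idP/idP => /allP uP; apply/allP=> z /[dup] zu /uP.
  by move=> /= zal; rewrite inE zal orbT.
rewrite /= inE => /orP[/eqP Dz|//].
by have:= le_x z zu; rewrite Dz (negPf (lt_y x xal)).
Qed.

Lemma uniq_strict al : pairwise (fun x y => ~~ e y x) al -> uniq al.
Proof.
rewrite uniq_pairwise; apply: sub_pairwise => x y; apply: contraNneq => ->.
by have:= e_total y y; rewrite orbb.
Qed.

Fixpoint violates u v : bool :=
  if u is x :: u' then if v is y :: v' then e y x || violates u' v' else false
  else false.

(** The exchange is offset by one column: at the first [y <= x], the new upper row is [v] up to [y]
    followed by [u] from [x] on. The prefixes trade rows, and row lengths [(a, b.+1)] become
    [(a.+1, b)]. *)
Fixpoint swap_tails u v : seq T * seq T :=
  match u, v with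
  | x :: u', y :: v' =>
    if e y x then (y :: u, v')
    else let p := swap_tails u' v' in (y :: p.1, x :: p.2)
  | _, _ => (u, v)
  end.

(** The place of the exchange is the first column whose upper entry is at most the lower one; a
    missing lower entry counts as infinite. *)
Fixpoint swap_back u v : seq T * seq T :=
  match u, v with
  | y :: u', x :: v' =>
    if e y x then (u', y :: v)
    else let p := swap_back u' v' in (x :: p.1, y :: p.2)
  | y :: u', [::] => (u', [:: y])
  | [::], _ => (u, v)
  end.

Lemma violatesPn x0 u v :
  reflect (forall j, j < size u -> j < size v -> ~~ e (nth x0 v j) (nth x0 u j))
          (~~ violates u v).
Proof.
elim: u v => [|x u IHu] [|y v] /=; try by apply: ReflectT.
rewrite negb_or; apply: (iffP andP) => [[exy /IHu uv] [|j] //= | uv].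
  exact: uv.
by split; [apply: (uv 0) | apply/IHu=> j; apply: (uv j.+1)].
Qed.

Lemma strict_le x y : ~~ e y x -> e x y.
Proof. by have:= e_total x y => /orP[-> // | ->]. Qed.

Lemma size_swap_tails u v : violates u v ->
  size (swap_tails u v).1 = (size u).+1 /\ size (swap_tails u v).2 = (size v).-1.
Proof.
elim: u v => [|x u IHu] [|y v] //=; case: ifP => //= _ uv.
have [-> ->] := IHu v uv; split=> //.
by case: v uv {IHu} => //; case: u.
Qed.

Lemma size_swap_back u v : size v < size u ->
  size (swap_back u v).1 = (size u).-1 /\ size (swap_back u v).2 = (size v).+1.
Proof.
elim: u v => [|y u IHu] [|x v] //=; rewrite ltnS; case: ifP => //= _ lt_vu.
have [-> ->] := IHu v lt_vu; split=> //.
by case: (u) lt_vu.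
Qed.

Lemma perm_swap_tails u v :
  perm_eq ((swap_tails u v).1 ++ (swap_tails u v).2) (u ++ v).
Proof.
elim: u v => [|x u IHu] [|y v] //=; apply/seq.permP=> P.
have := seq.permP (IHu v) P; case: ifP => _ /=; rewrite !count_cat /=; lia.
Qed.

(** The left bounds trade rows together with the prefixes. The condition [e x0 y0] serves a
    violation in the first column, where the rest of [v] must start after [x0]; further right, the
    preceding column supplies it. *)
Lemma path_swap_tails x0 y0 u v : path e x0 u -> path e y0 v -> violates u v ->
  path e y0 (swap_tails u v).1 /\ (e x0 y0 -> path e x0 (swap_tails u v).2).
Proof.
elim: u v x0 y0 => [|x u IHu] [|y v] //= x0 y0 /andP[lex pu] /andP[ley pv].
case: ifPn => [yx _ | xy uv] /=.
  rewrite ley yx pu; split=> // le00.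
  by apply: path_le pv; [exact: e_trans | apply: e_trans le00 ley].
have [p1 p2] := IHu v x y pu pv uv.
by rewrite ley lex p1 (p2 (strict_le xy)).
Qed.

(** The length gap of at least two leaves an upper entry above the reinserted [y]. By sortedness
    that entry is at least [y], so the result violates column strictness. *)
Lemma path_swap_back x0 y0 u v :
    path e y0 u -> path e x0 v -> (size v).+1 < size u -> e x0 y0 ->
  [/\ path e x0 (swap_back u v).1, path e y0 (swap_back u v).2
    & violates (swap_back u v).1 (swap_back u v).2].
Proof.
elim: u v x0 y0 => [|y u IHu] v x0 y0 //= /andP[ley pu] pv szv le00.
have stop: [/\ path e x0 u & violates u (y :: v)].
  case: u pu szv {IHu} => // z u /= /andP[yz pu] _; rewrite yz; split=> //.
  by rewrite pu (e_trans le00) ?(e_trans ley).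
case: stop => p1 p2.
case: v pv szv p2 => [|x v] /= => [_ _ p2|/andP[lex pv] szv p2].
  by rewrite ley.
case: ifPn => [yx|xy] /=; first by rewrite ley yx pv.
have [q1 q2 q3] := IHu v x y pu pv szv (strict_le xy).
by rewrite lex q1 ley q2 q3 orbT.
Qed.

Lemma swap_tailsK y0 u v : path e y0 v -> violates u v ->
  swap_back (swap_tails u v).1 (swap_tails u v).2 = (u, v).
Proof.
elim: u v y0 => [|x u IHu] [|y v] y0 //= /andP[_ pv].
case: ifPn => [yx _ | xy uv] /=.
  by case: v pv => //= z v /andP[-> _].
by rewrite (negPf xy) (IHu v y).
Qed.

Lemma swap_backK y0 u v : path e y0 u -> (size v).+1 < size u ->
  swap_tails (swap_back u v).1 (swap_back u v).2 = (u, v).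
Proof.
elim: u v y0 => [|y u IHu] v y0 //= /andP[_ pu] szv.
case: v szv => [|x v] /= szv.
  by case: u pu szv {IHu} => //= z u /andP[-> _].
case: ifPn => [yx|xy] /=; last by rewrite (negPf xy) (IHu v y).
by case: u pu szv {IHu} => //= z u /andP[-> _].
Qed.

End Multiwords.
Arguments mwords : simpl never.

Lemma mwords_map (T1 T2 : eqType) (f : T1 -> T2) a al :
  mwords a (map f al) = map (map f) (mwords a al).
Proof.
elim: a al => // a IHa; elim=> // y al IHal.
by rewrite map_cons !mwordsS -map_cons IHa IHal map_cat -!map_comp.
Qed.

(** * Complete homogeneous symmetric polynomials and their symmetry *)

Section CompleteHomogeneous.
Variable A : comNzRingType.
Local Open Scope ring_scope.
Implicit Types s : seq A.

Definition hom (a : nat) s : A := \sum_(u <- mwords a s) \prod_(x <- u) x.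

Lemma hom0 s : hom 0 s = 1.
Proof. by rewrite /hom mwords0 big_seq1 big_nil. Qed.

Lemma hom_nil a : hom a [::] = (a == 0%N)%:R.
Proof. by case: a => [|a]; rewrite ?hom0 // /hom mwords_nil big_nil. Qed.

Lemma hom_cons a x s : hom a.+1 (x :: s) = x * hom a (x :: s) + hom a.+1 s.
Proof.
rewrite /hom mwordsS big_cat big_map mulr_sumr; congr (_ + _).
by apply: eq_bigr => u _; rewrite big_cons.
Qed.

(** Expanding in both variables gives [(x + y) h_(a+1) - x y h_a] at [x, y, s], plus [h_(a+2)] at
    [s]; this is symmetric by induction on the degree. *)
Lemma hom_swap a x y s : hom a [:: x, y & s] = hom a [:: y, x & s].
Proof.
elim/ltn_ind: a => -[|[|a]] IHa; first by rewrite !hom0.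
  by rewrite !hom_cons !hom0 !mulr1 addrCA addrA addrC addrA.
rewrite (hom_cons a.+1 x) (hom_cons a.+1 y s) [RHS](hom_cons a.+1 y).
rewrite (hom_cons a.+1 x s) -(IHa a.+1) //.
have := hom_cons a x (y :: s); have := hom_cons a y (x :: s).
rewrite -(IHa a.+1) // -(IHa a (leqnSn _)).
move: (hom a.+1 [:: x, y & s]) (hom a [:: x, y & s]) (hom a.+1 (x :: s)).
move: (hom a.+1 (y :: s)) (hom a.+2 s) => hy c p q hx Ep1 Ep2.
have ->: hx = p - y * q by rewrite Ep1 addrAC subrr add0r.
have ->: hy = p - x * q by rewrite Ep2 addrAC subrr add0r.
ring.
Qed.

End CompleteHomogeneous.

Section JacobiTrudi.
Variables (A : comNzRingType) (T : eqType) (e : rel T).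
Hypotheses (e_total : total e) (e_trans : transitive e).
Variables (al : seq T) (w : T -> A).
Hypothesis al_strict : pairwise (fun x y => ~~ e y x) al.
Local Open Scope ring_scope.

Lemma homE a : hom a (map w al) = \sum_(u <- mwords a al) \prod_(x <- u) w x.
Proof.
by rewrite /hom mwords_map big_map; apply: eq_bigr => u _; rewrite big_map.
Qed.

Definition row_pairs a b : seq (seq T * seq T) :=
  [seq (u, v) | u <- mwords a al, v <- mwords b al].

Definition row_weight (p : seq T * seq T) : A :=
  (\prod_(x <- p.1) w x) * (\prod_(x <- p.2) w x).

Lemma mem_row_pairs a b p :
  (p \in row_pairs a b) = (p.1 \in mwords a al) && (p.2 \in mwords b al).
Proof.
case: p => u v /=; apply/allpairsP/andP => [[[u' v'] [? ? [-> ->]]]|[ual val]].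
  by split.
by exists (u, v).
Qed.

Lemma row_pairs_uniq a b : uniq (row_pairs a b).
Proof.
have Ual := uniq_strict e_total al_strict.
by apply: allpairs_uniq; rewrite ?mwords_uniq // => -[? ?] [? ?].
Qed.

Lemma sum_row_pairs a b :
  \sum_(p <- row_pairs a b) row_weight p = hom a (map w al) * hom b (map w al).
Proof.
rewrite big_allpairs_dep !homE mulr_suml; apply: eq_bigr => u _.
by rewrite mulr_sumr.
Qed.

Lemma row_weight_perm p q :
  perm_eq (p.1 ++ p.2) (q.1 ++ q.2) -> row_weight p = row_weight q.
Proof. by move=> pq; rewrite /row_weight -!big_cat; apply: perm_big. Qed.

(** The paths need left bounds: the two heads are taken, or the lower head twice when it is the
    smaller one. *)
Let sorted_min (u v : seq T) : sorted e u -> sorted e v -> violates e u v ->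
  exists x0 y0, [/\ e x0 y0, path e x0 u & path e y0 v].
Proof.
case: u v => [|x u] [|y v] //= pu pv _.
have exx z : e z z by have:= e_total z z; rewrite orbb.
case/orP: (e_total x y) => exy; first by exists x, y; rewrite pu pv !exx.
by exists y, y; rewrite /= pu pv !exx exy.
Qed.

(* The tails are exchanged at the first violation of column strictness, which
   can be located again in the resulting pair of rows. *)
Lemma perm_swap_row_pairs a b : (b < a)%N ->
  perm_eq [seq swap_tails e p.1 p.2 | p <- row_pairs a b.+1 & violates e p.1 p.2]
          (row_pairs a.+1 b).
Proof.
move=> leba; have memW c u := mem_mwords e_total e_trans c u al_strict.
have swapP p : p \in row_pairs a b.+1 -> violates e p.1 p.2 ->
    (swap_tails e p.1 p.2 \in row_pairs a.+1 b)
    && (swap_back e (swap_tails e p.1 p.2).1 (swap_tails e p.1 p.2).2 == p).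
  case: p => u v; rewrite !mem_row_pairs !memW /=.
  case/andP=> /and3P[/eqP su eu uA] /and3P[/eqP sv ev vA] uv.
  have [x0 [y0 [le00 pu pv]]] := sorted_min eu ev uv.
  have [-> ->] := size_swap_tails uv; rewrite su sv !eqxx /=.
  have [p1 p2] := path_swap_tails e_total e_trans pu pv uv.
  rewrite (path_sorted p1) (path_sorted (p2 le00)) (swap_tailsK pv uv) eqxx.
  by rewrite andbT /= -all_cat (perm_all _ (perm_swap_tails e u v)) all_cat uA.
apply: uniq_perm; rewrite ?row_pairs_uniq //.
  rewrite map_inj_in_uniq ?filter_uniq ?row_pairs_uniq // => p q.
  rewrite !mem_filter => /andP[vp /swapP/(_ vp)/andP[_ /eqP pK]].
  move=> /andP[vq /swapP/(_ vq)/andP[_ /eqP qK]] epq.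
  by rewrite -pK epq.
move=> q; apply/mapP/idP => [[p + ->]|].
  by rewrite mem_filter => /andP[vp /swapP/(_ vp)/andP[]].
case: q => u v; rewrite mem_row_pairs !memW /=.
case/andP=> /and3P[/eqP su eu uA] /and3P[/eqP sv ev vA].
have szvu: ((size v).+1 < size u)%N by rewrite su sv.
have [x0 [y0 [le00 pu pv]]] : exists x0 y0, [/\ e x0 y0, path e y0 u & path e x0 v].
  have exx z : e z z by have:= e_total z z; rewrite orbb.
  case: (u) (v) eu ev szvu => [|y u'] [|x v'] //= pu pv _.
    by exists y, y; rewrite !exx.
  case/orP: (e_total x y) => exy; first by exists x, y; rewrite pu pv !exx.
  by exists y, y; rewrite /= pu pv !exx exy.
exists (swap_back e u v); last by rewrite (swap_backK pu).
have [p1 p2 p3] := path_swap_back e_total e_trans pu pv szvu le00.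
rewrite mem_filter p3 mem_row_pairs !memW.
have [-> ->] := size_swap_back e (ltnW szvu).
rewrite su sv !eqxx (path_sorted p1) (path_sorted p2) /= -all_cat.
have := perm_swap_tails e (swap_back e u v).1 (swap_back e u v).2.
by rewrite (swap_backK pu) // => /perm_all <-; rewrite all_cat uA.
Qed.

(** [h_a h_(b+1)] sums over all pairs of rows, and the violating pairs have the same total as all
    pairs of lengths [a.+1] and [b]. Since [b < a], the latter lengths differ by at least two, so
    every such pair comes from an exchange. *)
Lemma jacobi_trudi2 a b : (b < a)%N ->
  \sum_(p <- row_pairs a b.+1 | ~~ violates e p.1 p.2) row_weight p
  = hom a (map w al) * hom b.+1 (map w al)
    - hom a.+1 (map w al) * hom b (map w al).
Proof.
move=> leba; rewrite -!sum_row_pairs.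
rewrite -(perm_big _ (perm_swap_row_pairs leba)) big_map big_filter.
rewrite [X in X - _](bigID (fun p => violates e p.1 p.2)) /=.
rewrite [X in X + _ - _](eq_bigr (fun p => row_weight (swap_tails e p.1 p.2))).
  by rewrite addrAC subrr add0r.
by move=> p _; apply: row_weight_perm; rewrite perm_sym perm_swap_tails.
Qed.

End JacobiTrudi.

(** * Semistandard tableaux with at most two rows *)

Lemma enum_ord_strict K : pairwise (fun x y : 'I_K => ~~ (y <= x)) (enum 'I_K).
Proof.
have : pairwise (relpre val ltn) (enum 'I_K).
  rewrite -pairwise_map val_enum_ord -sorted_pairwise ?iota_ltn_sorted //.
  exact: ltn_trans.
by apply: sub_pairwise => i j /=; rewrite -ltnNge.
Qed.

Section TwoRowSchur.
Variables (la : seq nat) (K : nat).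
Hypotheses (la_rows : size la <= 2) (la_gt0 : 0 < nth 0 la 0).
Implicit Types t : {ffun cell la -> 'I_K}.

Let le_letter : rel 'I_K := fun i j => i <= j.

Let le_total : total le_letter. Proof. by move=> i j; apply: leq_total. Qed.
Let le_trans : transitive le_letter.
Proof. by move=> j i k; apply: leq_trans. Qed.

Definition at_cell (i : 'I_(size la)) (j : 'I_(nth 0 la i)) : cell la :=
  Tagged (fun i : 'I_(size la) => 'I_(nth 0 la i)) j.

(** Empty for a row absent from [la], in agreement with the default 0 of [nth], so that shapes with
    one and two rows are treated alike. *)
Definition row_word t (k : nat) : seq 'I_K :=
  if insub k is Some i then codom (fun j => t (at_cell (i := i) j)) else [::].

Lemma size_row_word t k : size (row_word t k) = nth 0 la k.
Proof.
rewrite /row_word; case: insubP => [i _ <-|]; first by rewrite size_codom card_ord.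
by rewrite -leqNgt => /(nth_default 0) ->.
Qed.

Lemma nth_row_word x0 t (i : 'I_(size la)) (j : 'I_(nth 0 la i)) :
  nth x0 (row_word t i) j = t (at_cell j).
Proof.
by rewrite /row_word valK codomE (nth_map j) ?nth_ord_enum // size_enum_ord.
Qed.

Definition two_rows t := (row_word t 0, row_word t 1).

Lemma row_word_inj t t' :
  row_word t 0 = row_word t' 0 -> row_word t 1 = row_word t' 1 -> t = t'.
Proof.
move=> eq0 eq1; apply/ffunP=> -[i j]; have x0 := t (existT _ i j).
rewrite -[LHS](nth_row_word x0) -[RHS](nth_row_word x0).
case: i j => -[|[|i]] ltiK j //=; rewrite ?eq0 ?eq1 //.
by have := leq_trans ltiK la_rows.
Qed.

Lemma is_ssyt_rows t :
  is_ssyt t = [&& sorted le_letter (row_word t 0), sorted le_letter (row_word t 1)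
                & ~~ violates le_letter (row_word t 0) (row_word t 1)].
Proof.
have la0: 0 < size la by case: (la) la_gt0.
have x0 := t (existT _ (Ordinal la0) (Ordinal la_gt0)).
apply/idP/idP => [/'forall_forallP tP | /and3P[sorted0 sorted1]].
  have rowP k : sorted le_letter (row_word t k).
    apply/(sortedP x0) => j; rewrite size_row_word => ltj1.
    have [ltk|lek] := ltnP k (size la); last by rewrite nth_default in ltj1.
    pose i := Ordinal ltk; have ltj : j < nth 0 la i by apply: ltnW.
    rewrite (nth_row_word x0 t (Ordinal ltj)).
    rewrite (nth_row_word x0 t (i := i) (Ordinal ltj1)).
    have /andP[/implyP] := tP (at_cell (Ordinal ltj)) (at_cell (i := i) (Ordinal ltj1)).
    by rewrite /= eqxx leqnSn => /(_ isT).
  rewrite !rowP /=; apply/(violatesPn _ x0) => j; rewrite !size_row_word => lt0 lt1.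
  have la1 : 1 < size la by rewrite ltnNge; apply/negP=> /(nth_default 0) Dla; rewrite Dla in lt1.
  pose i0 := Ordinal la0; pose i1 := Ordinal la1.
  rewrite (nth_row_word x0 t (i := i0) (Ordinal lt0)).
  rewrite (nth_row_word x0 t (i := i1) (Ordinal lt1)).
  have /andP[_ /implyP] := tP (at_cell (i := i0) (Ordinal lt0)) (at_cell (i := i1) (Ordinal lt1)).
  by rewrite /= eqxx /le_letter ltnNge => /(_ isT).
move=> /(violatesPn _ x0) colP.
have {}colP k k' l : k = 0 -> k' = 1 -> l < nth 0 la k -> l < nth 0 la k' ->
    nth x0 (row_word t k) l < nth x0 (row_word t k') l.
  by move=> -> -> lt0 lt1; rewrite ltnNge; apply: colP; rewrite size_row_word.
apply/'forall_forallP => -[i j] [i' j'] /=.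
apply/andP; split; apply/implyP => /andP[].
  move=> /eqP Di; case: _ / Di j' => j' lejj'.
  rewrite -[t (existT _ i j)](nth_row_word x0) -[t (existT _ i j')](nth_row_word x0).
  have srt : sorted le_letter (row_word t i).
    by case: i {j j' lejj'} => -[|[|i]] ltiK //; have := leq_trans ltiK la_rows.
  apply: (sorted_leq_nth le_trans _ x0 srt); rewrite ?inE ?size_row_word //.
  by move=> ?; apply: leqnn.
move=> ltii' /eqP ejj'.
rewrite -[t (existT _ i j)](nth_row_word x0) -[t (existT _ i' j')](nth_row_word x0).
have [Di Di'] : i = 0 :> nat /\ i' = 1 :> nat.
  have := leq_trans (ltn_ord i') la_rows; lia.
by rewrite -ejj' colP // ejj'.
Qed.

Lemma perm_two_rows :
  perm_eq [seq two_rows (val t) | t : ssyt la K]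
    [seq p <- row_pairs (enum 'I_K) (nth 0 la 0) (nth 0 la 1)
       | ~~ violates le_letter p.1 p.2].
Proof.
have memE a u : (u \in mwords a (enum 'I_K)) = (size u == a) && sorted le_letter u.
  rewrite (mem_mwords le_total le_trans) ?enum_ord_strict //; congr (_ && _); rewrite andbC.
  by case: allP => // -[] i _; rewrite /= mem_enum.
apply: uniq_perm; first 1 last.
- by rewrite filter_uniq // (row_pairs_uniq le_total) // enum_ord_strict.
- move=> p; rewrite mem_filter mem_row_pairs !memE; apply/mapP/idP.
    move=> [[t tP] _ ->] /=; have := tP; rewrite is_ssyt_rows.
    by case/and3P=> -> -> ->; rewrite !size_row_word !eqxx.
  case: p => u v /= /and4P[uv /andP[/eqP su eu] /eqP sv ev].
  have x0 : 'I_K by case: (u) su la_gt0 => [<-|].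
  pose t : {ffun cell la -> 'I_K} :=
    [ffun x : cell la => nth x0 (nth [::] [:: u; v] (tag x)) (tagged x)].
  have rowE k : k < 2 -> row_word t k = nth [::] [:: u; v] k.
    move=> ltk2; have szk : size (nth [::] [:: u; v] k) = nth 0 la k.
      by case: k ltk2 => [|[|]].
    apply: (@eq_from_nth _ x0); rewrite size_row_word // => j ltj.
    have ltk : k < size la.
      by rewrite ltnNge; apply/negP=> /(nth_default 0) Dla; rewrite Dla in ltj.
    by rewrite (nth_row_word x0 t (i := Ordinal ltk) (Ordinal ltj)) ffunE.
  have tP : is_ssyt t by rewrite is_ssyt_rows !rowE //= eu ev uv.
  by exists (exist _ t tP); rewrite ?mem_enum // /two_rows /= !rowE.
- rewrite map_inj_uniq ?enum_uniq // => t t' [eq0 eq1].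
  by apply: val_inj; apply: row_word_inj.
Qed.

Lemma tab_weight_two_rows (A : comNzRingType) (x : 'I_K -> A) (t : ssyt la K) :
  tab_weight x t = row_weight x (two_rows (val t)).
Proof.
case: t => t tP; rewrite /tab_weight /row_weight /= {tP}.
rewrite (eq_bigr (fun u : cell la => x (t (at_cell (tagged u))))); last first.
  by move=> [i j].
rewrite -(sig_big_dep xpredT (fun _ => xpredT) (fun i j => x (t (at_cell (i := i) j)))) /=.
have rowE (i : 'I_(size la)) :
    (\prod_j x (t (at_cell (i := i) j)) = \prod_(y <- row_word t i) x y)%R.
  by rewrite /row_word valK /= big_map big_enum.
rewrite (eq_bigr _ (fun i _ => rowE i)).
rewrite (big_ord_widen 2 (fun k => \prod_(y <- row_word t k) x y)%R la_rows).
rewrite big_mkcond !big_ord_recl big_ord0 /= mulr1.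
have la0 : 0 < size la by case: (la) la_gt0.
rewrite la0; case: ifPn => //; rewrite -leqNgt => /(nth_default 0).
by rewrite -(size_row_word t); case: (row_word t 1); rewrite ?big_nil.
Qed.

Lemma schur_two_rows (A : comNzRingType) (x : 'I_K -> A) :
  schur la x =
  (\sum_(p <- row_pairs (enum 'I_K) (nth 0 la 0) (nth 0 la 1)
           | ~~ violates le_letter p.1 p.2) row_weight x p)%R.
Proof.
rewrite -big_filter -(perm_big _ perm_two_rows) /= big_map big_enum /=.
by apply: eq_bigr => t _; apply: tab_weight_two_rows.
Qed.

End TwoRowSchur.

(** * Gaussian binomial coefficients *)

Section HomTheory.
Variable A : comNzRingType.
Local Open Scope ring_scope.
Implicit Types s : seq A.

Lemma eq_hom_cons x s s' : (forall a, hom a s = hom a s') ->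
  forall a, hom a (x :: s) = hom a (x :: s').
Proof. by move=> eqs; elim=> [|a IHa]; rewrite ?hom0 // !hom_cons IHa eqs. Qed.

Lemma hom_perm s s' : perm_eq s s' -> forall a, hom a s = hom a s'.
Proof.
elim: s s' => [|x s IHs] s'; first by rewrite perm_sym => /perm_nilP->.
move/[dup]/perm_mem/(_ x); rewrite mem_head => /esym xs'.
case/path.splitPr: xs' => s1 s2.
rewrite -[x :: s2]cat1s perm_sym perm_catCA perm_sym perm_cons => ss12 a.
rewrite (eq_hom_cons x (IHs _ ss12)) => {ss12}.
elim: s1 a => //= y s1 IHs1 a; rewrite hom_swap.
exact: eq_hom_cons.
Qed.

Lemma hom_filter_neq0 a s : hom a s = hom a [seq x <- s | x != 0].
Proof.
elim: s a => //= x s IHs a; case: eqP => [->|_] /=; last exact: eq_hom_cons.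
by case: a => [|a]; rewrite ?hom0 // hom_cons mul0r add0r.
Qed.

Lemma hom_scale a c s : hom a (map ( *%R c) s) = c ^+ a * hom a s.
Proof.
elim: s a => [|x s IHs] a; first by case: a => [|a]; rewrite !hom_nil ?mulr0 ?mul1r.
elim: a => [|a IHa]; first by rewrite !hom0 mulr1.
by rewrite /= !hom_cons -/map IHs [hom a _]IHa exprS; ring.
Qed.

(* [hom (b - 1)], read as 0 for [b = 0]. *)
Definition hom_pred b s : A := if b is b'.+1 then hom b' s else 0.

End HomTheory.

Section TwoRowSchurHom.
Variables (A : comNzRingType) (K : nat) (x : 'I_K -> A).
Local Open Scope ring_scope.

Lemma schur_two_rows_hom la :
    (size la <= 2)%N -> (0 < nth 0 la 0)%N -> (nth 0 la 1 <= nth 0 la 0)%N ->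
  let ws := [seq x i | i <- enum 'I_K] in
  schur la x = hom (nth 0%N la 0) ws * hom (nth 0%N la 1) ws
               - hom (nth 0%N la 0).+1 ws * hom_pred (nth 0%N la 1) ws.
Proof.
move=> szla la_gt0 la_sorted ws; rewrite schur_two_rows //.
set e : rel 'I_K := fun i j => (i <= j)%N.
have e_total : total e by move=> i j; apply: leq_total.
have e_trans : transitive e by move=> j i k; apply: leq_trans.
have e_strict : pairwise (fun x y => ~~ e y x) (enum 'I_K) by exact: enum_ord_strict.
(* With an empty second row nothing can violate, and [hom_pred] makes the subtracted term vanish. *)
move: (nth _ _ 0) (nth _ _ 1) la_sorted => a [|b] ltba.
  rewrite /hom_pred mulr0 subr0 /ws -(sum_row_pairs _ _ a 0) big_mkcond.
  rewrite [LHS]big_seq [RHS]big_seq; apply: eq_bigr => -[u v].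
  rewrite mem_row_pairs /= mwords0 inE => /andP[_ /eqP->].
  by case: u.
exact: jacobi_trudi2.
Qed.

End TwoRowSchurHom.
Section GaussianPolynomials.
Local Open Scope ring_scope.
Implicit Types (p q s : {poly int}) (a b k m n r d : nat).

Definition powers k : seq {poly int} := [seq 'X^i | i <- iota 0 k].

(* The Gaussian binomial coefficient of [k - 1 + a] over [a]. *)
Definition gauss a k := hom a (powers k).

Lemma map_mulX_pow (l : seq nat) :
  [seq 'X * x | x <- [seq 'X^i : {poly int} | i <- l]] = [seq 'X^i | i <- map S l].
Proof. by rewrite -!map_comp; apply: eq_map => i /=; rewrite exprS. Qed.

Lemma gauss0 k : gauss 0 k = 1. Proof. exact: hom0. Qed.

(** Singles out the variable 1; the other powers are [X] times a shorter list. *)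
Lemma gaussSl a k : gauss a.+1 k.+1 = gauss a k.+1 + 'X^(a.+1) * gauss a.+1 k.
Proof.
rewrite /gauss /powers [iota 0 k.+1]/= -[1%N]addn0 iotaDl /= hom_cons mul1r.
by congr (_ + _); rewrite -hom_scale map_mulX_pow.
Qed.

(** Singles out the highest power [X^k], moved to the front by symmetry. *)
Lemma gaussSr a k : gauss a.+1 k.+1 = gauss a.+1 k + 'X^k * gauss a k.+1.
Proof.
have pk c : gauss c k.+1 = hom c ('X^k :: powers k).
  rewrite /gauss; apply: hom_perm; rewrite /powers -addn1 iotaD map_cat add0n.
  by rewrite -[_ :: _]cat1s perm_catC.
by rewrite !pk hom_cons addrC.
Qed.

Lemma gauss_coef0 a k : (gauss a k.+1)`_0 = 1.
Proof.
elim: a => [|a IHa]; first by rewrite gauss0 coefC.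
by rewrite gaussSl coefD IHa coefXnM addr0.
Qed.

Lemma gauss2 a : (1 - 'X) * gauss a 2 = 1 - 'X^(a.+1).
Proof.
have g1 c : gauss c 1 = 1.
  elim: c => [|c IHc]; first exact: gauss0.
  by rewrite gaussSl IHc /gauss hom_nil mulr0 addr0.
elim: a => [|a IHa]; first by rewrite gauss0 mulr1.
by rewrite gaussSl g1 mulr1 mulrDr IHa [in RHS]exprS; ring.
Qed.

Definition gauss_pred b k := hom_pred b (powers k).

Lemma gauss_predE b m : gauss b m.+1 = gauss_pred b m.+1 + 'X^b * gauss b m.
Proof. by case: b => [|b]; [rewrite !gauss0 add0r mulr1 | rewrite gaussSl]. Qed.

(** On a symmetric polynomial of degree [N] evaluated at [1, X, 0, ...], this reads off the
    coefficient of [s_(N-d,d)] when [0 < d] and [2d <= N]. *)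
Definition net p d := ((1 - 'X) * p)`_d.

Lemma netD p q d : net (p + q) d = net p d + net q d.
Proof. by rewrite /net mulrDr coefD. Qed.

Lemma netB p q d : net (p - q) d = net p d - net q d.
Proof. by rewrite /net mulrBr coefB. Qed.

Lemma net_high e d p : (d < e)%N -> net ('X^e * p) d = 0.
Proof. by move=> lt_de; rewrite /net mulrCA coefXnM lt_de. Qed.

Lemma net_top d p : net ('X^d * p) d = p`_0.
Proof.
by rewrite /net mulrCA coefXnM ltnn subnn coef0M coefB coefC coefX subr0 mul1r.
Qed.

(** Jacobi-Trudi for [s_(a,b)] at [1, X, ..., X^m], the two-variable form of the plethysm of
    [s_(a,b)] with [h_m]. *)
Definition row_plethysm b m a : {poly int} :=
  gauss a m.+1 * gauss b m.+1 - gauss a.+1 m.+1 * gauss_pred b m.+1.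

(** The common value of the coefficient for all [n >= r + b], with [a = n - b] replaced by its least
    value [r]. *)
Definition stable_net b r m := net ('X^b * (gauss r m.+1 * gauss b m)) r.

(** The Pascal recurrences cancel a common product and leave a correction starting at [X^(a.+1)],
    beyond degree [r]. In the remaining product, lowering [a] to [r] again discards only exponents
    above [r]. *)
Lemma net_row_plethysm b m a r : (r <= a)%N ->
  net (row_plethysm b m a) r = stable_net b r m.
Proof.
move=> lera; have ->: row_plethysm b m a = 'X^b * (gauss a m.+1 * gauss b m)
    - 'X^(a.+1) * (gauss a.+1 m * gauss_pred b m.+1).
  by rewrite /row_plethysm (gauss_predE b) (gaussSl a); ring.
rewrite netB [net ('X^(a.+1) * _) r]net_high ?subr0 // /stable_net; elim: a lera => [|a IHa].
  by rewrite leqn0 => /eqP->.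
rewrite leq_eqVlt => /orP[/eqP-> //|lera].
rewrite gaussSl -IHa // -[RHS]addr0.
rewrite -(net_high ('X^b * (gauss a.+1 m * gauss b m)) lera) -netD.
by congr net; ring.
Qed.

(** Splitting off the highest power in each factor gives corrections that start in degrees
    [b + m.+1] and [b + m], the second being zero for [b = 0]. Hence the summand [[b >= 1]] in the
    bound on [m]. *)
Lemma stable_netS b r m : (0 < r)%N ->
  stable_net b r m.+1 = stable_net b r m
    + net ('X^(b + m.+1) * (gauss r.-1 m.+2 * gauss b m.+1)) r
    + net ('X^(b + m) * (gauss r m.+1 * gauss_pred b m.+1)) r.
Proof.
case: r => // r _; rewrite /stable_net gaussSr -!netD; congr net.
have ->: gauss b m.+1 = gauss b m + 'X^m * gauss_pred b m.+1.
  by case: b => [|b]; [rewrite !gauss0 /gauss_pred mulr0 addr0 | rewrite gaussSr].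
rewrite !exprD; ring.
Qed.

Lemma stable_net_const b r m : (0 < r)%N ->
  (r - b + (1 <= b) <= m)%N -> stable_net b r m = stable_net b r (r - b + (1 <= b)).
Proof.
move=> r_gt0; elim: m => [|m IHm]; first by rewrite leqn0 => /eqP->.
rewrite leq_eqVlt => /orP[/eqP<- //|leMm].
rewrite stable_netS // IHm // net_high ?addr0; last by lia.
case: b leMm {IHm} => [|b] leMm; last by rewrite net_high ?addr0 //; lia.
by rewrite mulr0 mulr0 /net mulr0 coef0 addr0.
Qed.

(** Exactly one correction starts in degree [r], with coefficient 1: the first for [b = 0], where
    [m.+1 = r], and the second for [b >= 1], where [b + m = r]. *)
Lemma stable_net_drop b r m : (0 < r)%N -> (b < r)%N ->
  m.+1 = (r - b + (1 <= b))%N -> stable_net b r m.+1 = stable_net b r m + 1.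
Proof.
move=> r_gt0 ltbr Dm; rewrite stable_netS //.
case: b ltbr Dm => [|b] ltbr Dm.
  have ->: (0 + m.+1)%N = r by lia.
  by rewrite net_top /gauss_pred !mulr0 /net mulr0 coef0 addr0 gauss0 mulr1 gauss_coef0.
rewrite net_high ?addr0; last by lia.
have ->: (b.+1 + m)%N = r by lia.
by rewrite net_top coef0M !gauss_coef0.
Qed.

(** Here [a = r - 1], that is [n = r + b - 1], so the correction at [X^(a.+1)] reaches degree [r];
    as [m > 0], its cofactor has constant term 1. *)
Lemma net_row_plethysm_pred b m r : (0 < r)%N -> (0 < m)%N ->
  net (row_plethysm b m r.-1) r = stable_net b r m - 1.
Proof.
case: r m => // r [] // m _ _ /=.
have ->: row_plethysm b m.+1 r = 'X^b * (gauss r.+1 m.+2 * gauss b m.+1)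
   - 'X^(r.+1) * (gauss r.+1 m.+1 * gauss b m.+2).
  by rewrite /row_plethysm [gauss b m.+2]gauss_predE (gaussSl r); ring.
by rewrite netB net_top coef0M !gauss_coef0.
Qed.

(* Zeros pad the parts of [epsilon], so that it has exactly [r] parts. *)
Definition stable_types b r : seq (seq nat * seq nat) :=
  [seq p <- [seq (u, v) | u <- mwords r (0%N :: iota 2 r.-1), v <- mwords b (iota 1 r)]
     | sumn p.1 + sumn p.2 == r].

Lemma hom_pow a (l : seq nat) :
  hom a [seq 'X^i : {poly int} | i <- l] = \sum_(u <- mwords a l) 'X^(sumn u).
Proof.
rewrite /hom mwords_map big_map; apply: eq_bigr => u _; rewrite big_map.
by elim: u => [|i u IHu]; rewrite ?big_nil // big_cons IHu -exprD.
Qed.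

(** Up to terms above degree [r], deleting the variable [X] from [1, X, ..., X^r] multiplies [h_r]
    by [1 - X]; so excluding unmarked parts equal to 1 accounts for the factor in [net]. The factor
    [X^b] turns [h_b] at [1, ..., X^(r-1)] into [h_b] at [X, ..., X^r]. *)
Lemma size_stable_types b r : (0 < r)%N ->
  (size (stable_types b r))%:Z = stable_net b r r.
Proof.
case: r => // r _; pose Y := hom r.+1 [seq 'X^i : {poly int} | i <- 0%N :: iota 2 r].
have DY : Y = (1 - 'X) * gauss r.+1 r.+2 + 'X^(r.+2) * gauss r.+1 r.+1.
  have Eg a : gauss a r.+2 = hom a ('X :: [seq 'X^i | i <- 0%N :: iota 2 r]).
    by rewrite /gauss /powers /= hom_swap.
  have Eg' := gaussSl r r.+1.
  have ->: Y = gauss r.+1 r.+2 - 'X * gauss r r.+2 by rewrite !Eg hom_cons -/Y; ring.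
  by rewrite Eg' ['X^(r.+2)]exprS; ring.
have ->: stable_net b r.+1 r.+1 = (Y * ('X^b * gauss b r.+1))`_r.+1.
  rewrite DY mulrDl coefD -[in X in _ + X]mulrA coefXnM ltnSn addr0.
  by rewrite /stable_net /net; apply: (congr1 (fun p : {poly int} => p`_r.+1)); ring.
have ->: 'X^b * gauss b r.+1 = hom b [seq 'X^i : {poly int} | i <- iota 1 r.+1].
  by rewrite -hom_scale map_mulX_pow -[1%N]addn0 iotaDl.
have ->: Y * hom b [seq 'X^i | i <- iota 1 r.+1] =
    \sum_(p <- [seq (u, v) | u <- mwords r.+1 (0%N :: iota 2 r),
                            v <- mwords b (iota 1 r.+1)])
      'X^(sumn p.1) * 'X^(sumn p.2).
  rewrite /Y !hom_pow mulr_suml big_allpairs_dep.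
  by apply: eq_bigr => u _; rewrite mulr_sumr.
rewrite coef_sum /stable_types size_filter -sum1_count big_mkcond /=.
rewrite (big_morph _ PoszD (erefl 0%Z)); apply: eq_bigr => p _.
by rewrite -exprD coefXn eq_sym; case: eqP.
Qed.

End GaussianPolynomials.

(** * The plethysm in two variables *)

Section TwoVariables.
Local Open Scope ring_scope.

Lemma rmorph_schur (A B : comNzRingType) (f : {rmorphism A -> B}) la K (x : 'I_K -> A) :
  f (schur la x) = schur la (f \o x).
Proof.
rewrite /schur rmorph_sum; apply: eq_bigr => t _.
by rewrite /tab_weight rmorph_prod.
Qed.

(** By homogeneity, the first of the two surviving variables may be set to 1. *)
Definition two_vars N (i : 'I_N) : {poly int} :=
  if val i == 0%N then 1 else if val i == 1%N then 'X else 0.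

Lemma map_two_vars N : (2 <= N)%N ->
  [seq two_vars i | i <- enum 'I_N] = [:: 1, 'X & nseq (N - 2) 0].
Proof.
pose f i : {poly int} := if i == 0%N then 1 else if i == 1%N then 'X else 0.
case: N => [|[|N]] // _; rewrite 2!subSS subn0.
rewrite (eq_map (g := f \o val)) // map_comp val_enum_ord /=.
do 2 congr (_ :: _); rewrite -[2%N]/(0.+2).
by elim: N {1}0%N => //= N IHN k; rewrite IHN.
Qed.

Lemma hom_two_vars N a : (2 <= N)%N ->
  hom a [seq two_vars i | i <- enum 'I_N] = gauss a 2.
Proof.
move=> leN; rewrite map_two_vars // hom_filter_neq0 /gauss hom_filter_neq0.
have ->: [seq x <- [:: 1, 'X & nseq (N - 2) 0] | x != 0] = [:: 1; 'X : {poly int}].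
  rewrite /= oner_eq0 polyX_eq0 /=; do 2 congr (_ :: _).
  by elim: (N - 2)%N => //= k ->; rewrite eqxx.
by rewrite /powers /= expr0 expr1 oner_eq0 polyX_eq0.
Qed.

(** The first column increases strictly, so its third entry is the index of a variable sent to 0. *)
Lemma schur_two_vars_eq0 la N : (2 < size la)%N -> (forall i, i < size la -> 0 < nth 0 la i)%N ->
  schur la (@two_vars N) = 0.
Proof.
move=> szla la_gt0; rewrite /schur big1 // => -[t tP] _.
have lt k : (k <= 2)%N -> (k < size la)%N by move=> /leq_ltn_trans; apply.
pose c k (lek : (k <= 2)%N) : cell la :=
  at_cell (i := Ordinal (lt k lek)) (Ordinal (la_gt0 k (lt k lek))).
have [lt01 lt12] : (t (c 0%N isT) < t (c 1%N isT))%N /\ (t (c 1%N isT) < t (c 2%N isT))%N.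
  have /'forall_forallP tP' := tP.
  split; first by have /andP[_ /implyP->] := tP' (c 0%N isT) (c 1%N isT).
  by have /andP[_ /implyP->] := tP' (c 1%N isT) (c 2%N isT).
have gt1 : (1 < t (c 2%N isT))%N.
  exact: leq_ltn_trans (leq_ltn_trans (leq0n _) lt01) lt12.
have x0 : two_vars (t (c 2%N isT)) = 0.
  by rewrite /two_vars /=; case: (nat_of_ord _) gt1 => [|[|n]].
by rewrite /tab_weight (bigD1 (c 2%N isT)) //= x0 mul0r.
Qed.

Lemma schur_two_vars la N : (2 <= N)%N ->
    (size la <= 2)%N -> (0 < nth 0 la 0)%N -> (nth 0 la 1 <= nth 0 la 0)%N ->
  (1 - 'X) * schur la (@two_vars N) = 'X^(nth 0%N la 1) - 'X^((nth 0%N la 0).+1).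
Proof.
move=> leN szla la_gt0 la_sorted; rewrite schur_two_rows_hom //= !hom_two_vars //.
have ->: hom_pred (nth 0%N la 1) [seq two_vars i | i <- enum 'I_N]
      = gauss_pred (nth 0%N la 1) 2.
  by rewrite /gauss_pred; case: (nth _ _ 1) => //= b; rewrite hom_two_vars.
have X1 : 1 - 'X != 0 :> {poly int}.
  rewrite subr_eq0 eq_sym; apply/eqP => /(congr1 (size \o polyseq)).
  by rewrite /= size_polyX size_poly1.
(* One more factor [1 - X] turns each Gaussian binomial in two variables into some [1 - X^k]. *)
apply: (mulfI X1); set b := nth 0%N la 1; set a := nth 0%N la 0.
have gp : (1 - 'X) * gauss_pred b 2 = 1 - 'X^b.
  by case: (b) => [|b']; rewrite ?gauss2 // mulr0 subrr.
transitivity (((1 - 'X) * gauss a 2) * ((1 - 'X) * gauss b 2)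
   - ((1 - 'X) * gauss a.+1 2) * ((1 - 'X) * gauss_pred b 2)); first by ring.
rewrite gp !gauss2 !exprS; ring.
Qed.

Definition word_products m (s : seq {poly int}) : seq {poly int} :=
  [seq \prod_(x <- u) x | u <- mwords m s].

Lemma word_productsS m x s : word_products m.+1 (x :: s) =
  [seq x * y | y <- word_products m (x :: s)] ++ word_products m.+1 s.
Proof.
rewrite /word_products mwordsS map_cat -!map_comp; congr (_ ++ _).
by apply: eq_map => u /=; rewrite big_cons.
Qed.

Lemma filter_scale_neq0 (x : {poly int}) s : x != 0 ->
  [seq y <- [seq x * y | y <- s] | y != 0] = [seq x * y | y <- s & y != 0].
Proof.
move=> x0; rewrite filter_map; congr map; apply: eq_filter => y /=.
by rewrite mulf_eq0 (negPf x0).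
Qed.

Lemma word_products_two_vars m k :
  [seq y <- word_products m [:: 1, 'X & nseq k 0] | y != 0] = powers m.+1.
Proof.
have zeros l : [seq y <- word_products l.+1 (nseq k 0) | y != 0] = [::].
  elim: k => //= k IHk; rewrite word_productsS filter_cat IHk cats0.
  by elim: (word_products _ _) => //= y s ->; rewrite mul0r eqxx.
have pows l : [seq y <- word_products l ('X :: nseq k 0) | y != 0] = [:: 'X^l].
  elim: l => [|l IHl]; first by rewrite /word_products /= big_nil oner_eq0.
  rewrite word_productsS filter_cat zeros cats0 filter_scale_neq0 ?polyX_eq0 //.
  by rewrite IHl /= exprS.
elim: m => [|m IHm]; first by rewrite /word_products /= big_nil oner_eq0.
rewrite word_productsS filter_cat pows filter_scale_neq0 ?oner_eq0 // IHm.
rewrite (eq_map (@mul1r _)) map_id.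
by rewrite /powers -[in RHS]addn1 iotaD map_cat.
Qed.

(** These are the letters substituted into [s_nu]; the extra zeros do not affect [hom], by
    [hom_filter_neq0]. *)
Lemma perm_row_letters m N : (0 < m)%N -> (2 <= N)%N ->
  perm_eq [seq y <- [seq tab_weight (@two_vars N) (enum_val j)
                      | j <- enum 'I_#|{: ssyt [:: m] N}|] | y != 0]
          (powers m.+1).
Proof.
move=> m_gt0 leN; rewrite -(word_products_two_vars m (N - 2)) -map_two_vars //.
apply: perm_filter; rewrite (map_comp _ enum_val).
have perm_enum : perm_eq [seq enum_val j | j <- enum 'I_#|{: ssyt [:: m] N}|]
                         (enum {: ssyt [:: m] N}).
  apply: uniq_perm; rewrite ?enum_uniq //.
    by rewrite map_inj_uniq ?enum_uniq // => i j /enum_val_inj.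
  move=> t; rewrite mem_enum; apply/mapP; exists (enum_rank t); rewrite ?mem_enum //.
  by rewrite enum_rankK.
apply: perm_trans (perm_map _ perm_enum) _.
rewrite (eq_map (tab_weight_two_rows _ _ (@two_vars N))) //.
rewrite map_comp; apply: perm_trans (perm_map _ (perm_two_rows _ _ _)) _ => //.
rewrite /word_products mwords_map -map_comp /= /row_pairs mwords0.
rewrite (eq_map (g := fun u => \prod_(i <- u) two_vars i)); last first.
  by move=> u /=; rewrite big_map.
elim: (mwords m _) => //= u s IHs; case: u => [|i u] /=;
by rewrite /row_weight /= [X in _ * X]big_nil mulr1 perm_cons.
Qed.

(** The larger part is at least [r] because [2r <= N], so the subtracted power in [schur_two_vars]
    lies above degree [r] and only a second part equal to [r] is detected. *)
Lemma schur_two_vars_coef N (ta : intpartn N) r : (2 <= N)%N -> (0 < r)%N ->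
  (r + r <= N)%N ->
  ((1 - 'X) * schur ta (@two_vars N))`_r = (parts ta == [:: N - r; r]%N)%:R.
Proof.
move=> leN r_gt0 le2r; have /and3P[] := valP ta; rewrite -/(parts ta).
move: (parts ta) => la la_sorted la0 /eqP sum_la.
have la_gt0 i : (i < size la)%N -> (0 < nth 0 la i)%N.
  by move=> lti; rewrite lt0n; apply: contraNneq la0 => <-; apply: mem_nth.
have [sz3|sz2] := ltnP 2 (size la).
  rewrite schur_two_vars_eq0 // mulr0 coef0; case: eqP => // Dla.
  by rewrite Dla in sz3.
case: la sz2 la_sorted sum_la la_gt0 {la0} => [|a [|b []]] //= _.
- by move=> _ D; rewrite -D in leN.
- rewrite addn0 => _ Da la_gt0; rewrite schur_two_vars //= ?(la_gt0 0%N) //.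
  rewrite expr0 coefB coef1 coefXn.
  have -> : (r == 0)%N = false by lia.
  have -> : (r == a.+1) = false by lia.
  by rewrite subrr eqseq_cons andbF.
rewrite andbT addn0 => leba sab la_gt0; rewrite schur_two_vars //= ?(la_gt0 0%N) //.
rewrite coefB !coefXn; have ->: (r == a.+1) = false by lia.
rewrite subr0; congr (nat_of_bool _)%:R; rewrite !eqseq_cons andbT.
by apply/eqP/andP => [->|[_ /eqP->//]]; split; apply/eqP; lia.
Qed.

(** Evaluating any Schur expansion of the plethysm in two variables and applying [net] kills every
    term but the one for [(N - r, r)]; the coefficient is thus determined whichever expansion is
    given. *)
Lemma plethysm_coef_net nu m la N (k : int) r : (0 < m)%N ->
    N = (sumn nu * sumn [:: m])%N -> (0 < r)%N -> (r + r <= N)%N ->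
    la = [:: N - r; r]%N ->
    (size nu <= 2)%N -> (0 < nth 0 nu 0)%N -> (nth 0 nu 1 <= nth 0 nu 0)%N ->
  plethysm_coef_is nu [:: m] la k ->
  k = net (row_plethysm (nth 0%N nu 1) m (nth 0%N nu 0)) r.
Proof.
move=> m_gt0 DN r_gt0 le2r Dla sz_nu nu_gt0 nu_sorted.
have leN : (2 <= N)%N by lia.
rewrite /plethysm_coef_is; cbv zeta; rewrite -DN => -[c Ec [ta0 Dta0 <-]].
pose ev : {rmorphism {mpoly int[N]} -> {poly int}} := mmap (intmul 1) (@two_vars N).
have evvar i : ev (var i) = two_vars i by rewrite /ev /= mmapX mmap1U.
have evschur (ta : seq nat) : ev (schur ta (@var N)) = schur ta (@two_vars N).
  rewrite rmorph_schur; apply: eq_bigr => t _; apply: eq_bigr => i _.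
  exact: evvar.
have evL : ev (schur_plethysm nu [:: m] N) = row_plethysm (nth 0%N nu 1) m (nth 0%N nu 0).
  rewrite rmorph_schur schur_two_rows_hom //.
  set ws := map _ _; have homE a : hom a ws = gauss a m.+1.
    rewrite /ws hom_filter_neq0; apply: hom_perm.
    rewrite (eq_map (g := fun j => tab_weight (@two_vars N) (enum_val j))).
      exact: perm_row_letters.
    by move=> j /=; rewrite /tab_weight rmorph_prod; apply: eq_bigr => i _.
  by rewrite !homE /row_plethysm /gauss_pred; case: (nth _ _ 1) => //= b; rewrite homE.
have term (ta : intpartn N) :
    ((1 - 'X) * ev (schur ta (@var N) *~ c ta))`_r = c ta *+ (parts ta == la).
  rewrite rmorphMz evschur mulrzAr coefMrz schur_two_vars_coef // -Dla.
  by case: (_ == _); rewrite ?mul0rz ?intz.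
rewrite -evL Ec rmorph_sum /= /net mulr_sumr coef_sum (bigD1 ta0) //= term Dta0.
rewrite eqxx big1 ?addr0 // => ta neq_ta; rewrite term; case: eqP => // Dta.
case/eqP: neq_ta; apply: val_inj; apply: val_inj; apply: (inj_map val_inj).
exact: etrans Dta (esym Dta0).
Qed.

End TwoVariables.

(** * Multiplicities of one-dimensional modules *)

Section QuotientMaps.
Local Open Scope ring_scope.
Variables (F : fieldType) (n s : nat) (U : 'M[F]_n).

Lemma sub_in_factmodK m (W : 'M_(m, n)) : (W - val_factmod (in_factmod U W) <= U)%MS.
Proof. by rewrite -{1}[W](add_sub_fact_mod U) addrK val_submodP. Qed.

(** A map vanishing on [U] factors through the quotient, and [val_factmod 1%:M *m f] is the induced
    map. *)
Lemma in_factmodMl m (W : 'M_(m, n)) (f : 'M_(n, s)) : U *m f = 0 ->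
  in_factmod U W *m (val_factmod 1%:M *m f) = W *m f.
Proof.
move=> Uf0; have /submxP[w Dw] := sub_in_factmodK W.
rewrite mulmxA -val_factmodE; apply/esym/eqP; rewrite -subr_eq0 -mulmxBl Dw.
by rewrite -mulmxA Uf0 mulmx0.
Qed.

End QuotientMaps.

Section Multiplicity.
Local Open Scope ring_scope.
Variables (F : fieldType) (D : Type).
Implicit Types M L : rmod F D.

Lemma iso_rmod_sym M L : iso_rmod M L -> iso_rmod L M.
Proof.
case=> dML [f ffree fM]; split=> //.
have ffull : row_full f by rewrite /row_full (eqP ffree) dML.
have pf : pinvmx f *m f = 1%:M by apply: mulVpmx.
have fp : f *m pinvmx f = 1%:M by apply: mulmxVp.
exists (pinvmx f); first by apply/row_freeP; exists f.
by move=> a; rewrite -[RHS]mulmx1 -fp !mulmxA -(mulmxA (pinvmx f)) fM mulmxA pf mul1mx.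
Qed.

Lemma iso_rmod_trans M1 M2 M3 : iso_rmod M1 M2 -> iso_rmod M2 M3 -> iso_rmod M1 M3.
Proof.
case=> d12 [f ffree fM] [d23 [g gfree gM]]; split; first exact: etrans d12 d23.
exists (f *m g); last by move=> a; rewrite mulmxA fM -mulmxA gM mulmxA.
by rewrite /row_free mxrankMfree.
Qed.

Lemma rdim_quot_rmod M (U : 'M_(rdim M)) : rdim (quot_rmod U) = (rdim M - \rank U)%N.
Proof. exact: mxrank_coker. Qed.

Lemma sub_rmod_act M (U : 'M_(rdim M)) m (W : 'M_(m, \rank U)) a : submodule U ->
  val_submod (W *m ract (sub_rmod U) a) = val_submod W *m ract M a.
Proof.
move=> subU; have -> : W *m ract (sub_rmod U) a = in_submod U (val_submod W *m ract M a).
  by rewrite /= [in LHS](in_submodE U) [in RHS](in_submodE U) (val_submodE W) !mulmxA.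
rewrite in_submodK //; apply: submx_trans (subU a).
exact: submxMr (val_submodP _).
Qed.

(** A nonzero submodule of least rank is simple. *)
Lemma exists_simple_submodule M : (0 < rdim M)%N ->
  exists2 U : 'M_(rdim M), submodule U & (0 < \rank U)%N /\ simple_rmod (sub_rmod U).
Proof.
move=> M_gt0; pose P k := `[< exists2 U : 'M_(rdim M), submodule U
                             & (0 < \rank U)%N /\ \rank U = k >].
have exP : exists k, P k.
  exists (rdim M); apply/asboolP; exists 1%:M; last by rewrite mxrank1.
  by move=> a; rewrite submx1.
case: (ex_minnP exP) => k /asboolP[U subU [U_gt0 <-]] minU.
exists U => //; split=> //; split=> // W subW.
have [->|W0] := eqVneq W 0; [by left | right].
(* [V] is the submodule [W] of [U] seen inside [M]; minimality of the rank of [U] forces [W] to be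
   full. *)
pose V := <<val_submod W>>%MS.
have rankV : \rank V = \rank W.
  by rewrite mxrank_gen /val_submod /= mxrankMfree ?row_base_free.
have /minU leU : P (\rank V).
  apply/asboolP; exists V; last by rewrite rankV lt0n mxrank_eq0.
  move=> a; rewrite (eqmxMr _ (genmxE _)) genmxE -sub_rmod_act // val_submodS.
  exact: subW.
by rewrite /row_full eqn_leq rank_leq_col -rankV.
Qed.

(** [mult] is a choice with default 0, so bounding it from below requires that a composition series
    exists. *)
Lemma comp_mult_exists L M : exists k, comp_mult L M k.
Proof.
have [N] := ubnP (rdim M); elim: N M => // N IHN M ltM.
have [M0|M_gt0] := posnP (rdim M); first by exists 0%N; apply: CompMult0.
have [U subU [U_gt0 simpleU]] := exists_simple_submodule M_gt0.
have [|k] := IHN (quot_rmod U); last first.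
  by exists (`[< iso_rmod (sub_rmod U) L >] + k)%N; apply: CompMultS.
by rewrite rdim_quot_rmod; move: ltM U_gt0 M_gt0; lia.
Qed.

Variable chi : D -> F.

Definition char_rmod : rmod F D := RMod (fun a => (chi a)%:M : 'M_1).

(** The columns of [f] are homomorphisms from [M] to [char_rmod], and the rank of [f] is the
    dimension of their span. *)
Definition intertwines M s (f : 'M_(rdim M, s)) : Prop :=
  forall a, ract M a *m f = chi a *: f.

Lemma iso_char_rmod M (f : 'M_(rdim M, 1)) :
  rdim M = 1%N -> row_free f -> intertwines f -> iso_rmod M char_rmod.
Proof.
move=> dM ffree fM; split=> //; exists f => // a.
by rewrite fM -mul_scalar_mx scalar_mxC.
Qed.

Lemma intertwines_quot M (U : 'M_(rdim M)) s (f : 'M_(rdim M, s)) :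
    intertwines f -> U *m f = 0 ->
  intertwines (M := quot_rmod U) (val_factmod 1%:M *m f).
Proof.
move=> fM Uf0 a; rewrite /ract /= -/(ract M a) in_factmodMl // -mulmxA fM.
by rewrite scalemxAr.
Qed.

Lemma intertwines_sub M (U : 'M_(rdim M)) s (f : 'M_(rdim M, s)) : submodule U ->
  intertwines f -> intertwines (M := sub_rmod U) (val_submod 1%:M *m f).
Proof.
move=> subU fM a; rewrite mulmxA -val_submodE -[ract _ a]mul1mx sub_rmod_act //.
by rewrite -mulmxA fM scalemxAr.
Qed.

(* A factor [U] of the series carries a nonzero intertwiner only if it is
   isomorphic to [L], and then it accounts for at most one dimension. *)
Lemma comp_mult_ge L M k s (f : 'M_(rdim M, s)) : iso_rmod L char_rmod ->
  comp_mult L M k -> intertwines f -> (\rank f <= k)%N.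
Proof.
move=> isoL cM; elim: cM s f => {M k} [M M0|M U k subU simU cU IHU] s f fM.
  by rewrite -M0; apply: rank_leq_row.
have quot_bound s' (h : 'M_(rdim M, s')) : intertwines h -> U *m h = 0 -> (\rank h <= k)%N.
  move=> hM Uh0; apply: leq_trans (IHU _ _ (intertwines_quot hM Uh0)).
  by rewrite -[h in leqLHS]mul1mx -(in_factmodMl _ Uh0) mxrankM_maxr.
have kill s' (h : 'M_(rdim M, s')) : val_submod (1%:M : 'M_(\rank U)) *m h = 0 -> U *m h = 0.
  move=> h0; have /submxP[w Dw] : (U <= val_submod (1%:M : 'M_(\rank U)))%MS.
    by rewrite val_submod1.
  by rewrite Dw -mulmxA h0 mulmx0.
set g := val_submod (1%:M : 'M_(\rank U)) *m f.
have gU : intertwines (M := sub_rmod U) g by apply: intertwines_sub.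
have ker_sub : submodule (M := sub_rmod U) (kermx g).
  move=> a; rewrite sub_kermx -mulmxA (gU a) -scalemxAr mulmx_ker scaler0 //.
(* By simplicity [f] is injective or zero on [U]; in the latter case it descends to the quotient. *)
have [U_gt0 sub_cases] := simU; have [/eqP ker0|kerfull] := sub_cases _ ker_sub; last first.
  apply: leq_trans (leq_addl _ _); apply: quot_bound => //.
  have g0 : g = 0.
    by apply/eqP; rewrite -[g]mul1mx -sub_kermx submx_full.
  exact: kill.
rewrite kermx_eq0 in ker0.
have scalarU a : ract (sub_rmod U) a = (chi a)%:M.
  by apply: (row_free_inj ker0); rewrite (gU a) mul_scalar_mx.
have dU : \rank U = 1%N.
  (* The action on [U] is now scalar, so every subspace is a submodule; taking a line shows that [U]
     has dimension 1. *)
  have /sub_cases[/eqP|] : submodule (M := sub_rmod U) (pid_mx 1).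
  - by move=> a; rewrite scalarU mul_mx_scalar scalemx_sub.
  - by rewrite -mxrank_eq0 rank_pid_mx.
  - by rewrite /row_full rank_pid_mx // => /eqP.
have -> : `[< iso_rmod (sub_rmod U) L >].
  apply/asboolP; apply: iso_rmod_trans (iso_rmod_sym isoL).
  apply: (iso_char_rmod (M := sub_rmod U) (f := const_mx 1)) => //.
    rewrite /row_free eqn_leq rank_leq_row /= {1}dU lt0n mxrank_eq0.
    by apply/eqP=> /matrixP/(_ (Ordinal U_gt0) ord0)/eqP; rewrite !mxE oner_eq0.
  by move=> a; rewrite scalarU mul_scalar_mx.
(* Composing [f] with the cokernel of [g] makes it vanish on [U] and lowers the rank by at most
   [\rank g <= 1], which the factor [U] pays for. *)
rewrite -(mxrank_mul_ker f (cokermx g)) addnC leq_add //.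
  apply: leq_trans (mxrankS (capmxSr _ _)) _.
  rewrite mxrank_ker mxrank_coker.
  by have := leq_trans (rank_leq_row g) (eq_leq dU); have := rank_leq_col g; lia.
apply: quot_bound; first by move=> a; rewrite mulmxA fM scalemxAl.
by apply: kill; rewrite mulmxA -/g mulmx_coker.
Qed.

Lemma mult_ge L M s (f : 'M_(rdim M, s)) : iso_rmod L char_rmod ->
  intertwines f -> (\rank f <= mult M L)%N.
Proof.
move=> isoL fM; apply: (comp_mult_ge isoL) fM.
exact: (@classical_sets.xgetPex _ 0%N (comp_mult L M) (comp_mult_exists L M)).
Qed.

Lemma mult_quot_ge L M (U : 'M_(rdim M)) s (f : 'M_(rdim M, s)) :
    iso_rmod L char_rmod -> intertwines f -> U *m f = 0 ->
  (\rank f <= mult (quot_rmod U) L)%N.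
Proof.
move=> isoL fM Uf0; apply: leq_trans (mult_ge isoL (intertwines_quot fM Uf0)).
by rewrite -[f in leqLHS]mul1mx -(in_factmodMl _ Uf0) mxrankM_maxr.
Qed.

Lemma quot_iso_char M (U : 'M_(rdim M)) (g : 'M_(rdim M, 1)) :
    g != 0 -> (kermx g <= U)%MS -> U *m g = 0 -> intertwines g ->
  iso_rmod (quot_rmod U) char_rmod.
Proof.
move=> g0 kerU Ug0 gM; have g1 : \rank g = 1%N.
  by apply/eqP; rewrite eqn_leq rank_leq_col lt0n mxrank_eq0.
have dimU : rdim (quot_rmod U) = 1%N.
  have := mxrankS kerU; have: (U <= kermx g)%MS by rewrite sub_kermx Ug0.
  move/mxrankS; rewrite rdim_quot_rmod mxrank_ker g1.
  by have := rank_leq_row g; rewrite g1; lia.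
apply: (@iso_char_rmod (quot_rmod U) (val_factmod (1%:M : 'M_(\rank (cokermx U))) *m g) dimU).
  rewrite /row_free eqn_leq rank_leq_row /=; apply: leq_trans (eq_leq (etrans dimU (esym g1))) _.
  by rewrite -[g in leqLHS]mul1mx -(in_factmodMl _ Ug0) mxrankM_maxr.
exact: intertwines_quot.
Qed.

(** In a one-dimensional module the zero submodule is maximal, so the radical is 0. *)
Lemma head_iso_char M : iso_rmod M char_rmod -> iso_rmod (head_rmod M) char_rmod.
Proof.
case=> dM [f ffree fM].
have max0 : maximal_submodule (0 : 'M_(rdim M)).
  split=> [a||W _ _]; first by rewrite mul0mx.
    by rewrite /row_full mxrank0 dM.
  have [->|W0] := eqVneq W 0; [by left | right].
  by rewrite /row_full eqn_leq rank_leq_col {1}dM lt0n mxrank_eq0.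
have radE : forall X : 'M_(rdim M), (X <= radical M)%MS <->
    (forall W, maximal_submodule W -> (X <= W)%MS).
  apply: (@classical_sets.xgetPex _ 0 (fun U : 'M_(rdim M) =>
    forall X : 'M_(rdim M),
      (X <= U)%MS <-> (forall W, maximal_submodule W -> (X <= W)%MS))).
  exists 0 => X; split=> [|/(_ 0 max0) //].
  by rewrite submx0 => /eqP-> W _; apply: sub0mx.
have /(_ _ max0) := (radE (radical M)).1 (submx_refl _); rewrite submx0 => /eqP rad0.
apply: (quot_iso_char (g := f)).
- by rewrite -mxrank_eq0 (eqP ffree) dM.
- by rewrite (eqP (_ : kermx f == 0)) ?sub0mx // kermx_eq0.
- by rewrite rad0 mul0mx.
- by move=> a; rewrite fM mul_mx_scalar.
Qed.

End Multiplicity.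

(** * Balanced tensor products with the trivial module *)

Section RowSpecht.
Local Open Scope ring_scope.
Variables (F : fieldType) (b : nat) (T : finType).
Hypothesis cardT : #|T| = b.

Let la := row_partition b.
Let G := [set: {perm T}]%G.

Lemma row_stab_row : row_stab la T = [set: {perm T}].
Proof.
have row0 (x : T) : tab_row la x = 0%N.
  have lt_xb : (enum_rank x < b)%N by rewrite -cardT.
  rewrite /tab_row /la /row_partition; case: eqP lt_xb => [-> //|_ lt_xb].
  by rewrite /reshape_index /= (eqP lt_xb).
by apply/setP=> s; rewrite !inE; apply/forallP=> x; rewrite !row0.
Qed.

Lemma col_stab_row : col_stab la T = [set 1%g].
Proof.
have colE (x : T) : tab_col la x = enum_rank x.
  have lt_xb : (enum_rank x < b)%N by rewrite -cardT.
  rewrite /tab_col /reshape_offset /la /row_partition.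
  case: eqP lt_xb => [-> //|_ lt_xb].
  by rewrite /reshape_index /= (eqP lt_xb) /= subn0.
apply/setP=> s; rewrite !inE; apply/forallP/eqP => [sP|-> x]; last by rewrite perm1.
apply/permP=> x; rewrite perm1; apply: enum_rank_inj; apply: val_inj.
by have /eqP := sP x; rewrite !colE.
Qed.

Lemma polytabloid_row :
  polytabloid F la T = \sum_(u : {perm T}) delta_mx 0 (gring_index G u).
Proof.
rewrite /polytabloid row_stab_row col_stab_row big_mkcond /=.
apply: eq_bigr => u _; rewrite inE big_set1 mulg1 odd_perm1 scale1r.
by [].
Qed.

Lemma polytabloid_row_neq0 : polytabloid F la T != 0.
Proof.
rewrite polytabloid_row; apply/eqP=> /matrixP/(_ 0 (gring_index G 1%g))/eqP.
rewrite summxE (bigD1 1%g) //= big1 ?mxE ?addr0 ?eqxx ?oner_eq0 // => u u1.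
rewrite mxE eqxx /=; case: eqP => // /(congr1 enum_val).
by rewrite !gring_indexK ?inE // => /eqP; rewrite eq_sym (negPf u1).
Qed.

Lemma polytabloid_row_fix g :
  polytabloid F la T *m regular_repr F G g = polytabloid F la T.
Proof.
rewrite polytabloid_row mulmx_suml [RHS](reindex_inj (mulIg g)) /=.
by apply: eq_bigr => u _; rewrite -rowE rowK gring_indexK ?inE.
Qed.

(** For a single row the polytabloid is the sum of all group elements, which is nonzero and fixed by
    right multiplication, so it spans a trivial module. *)
Lemma specht_row : rdim (specht F la T) = 1%N /\
  forall g, ract (specht F la T) g = 1%:M.
Proof.
set u := polytabloid F la T; set rG := regular_repr F G.
have modu : mxmodule rG u.
  by apply/mxmoduleP=> g _; rewrite polytabloid_row_fix.
have sub_u : (cyclic_mx rG u <= u)%MS by apply: cyclic_mx_sub.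
split=> [|g].
  apply/eqP; rewrite eqn_leq (leq_trans (mxrankS sub_u)) ?rank_leq_row //=.
  by rewrite lt0n mxrank_eq0 cyclic_mx_eq0 polytabloid_row_neq0.
rewrite /= /submod_mx; set v := val_submod _.
have -> : v *m rG g = v; last exact: val_submodK.
have /submxP[w ->] : (v <= u)%MS by apply: submx_trans sub_u; apply: val_submodP.
by rewrite -mulmxA polytabloid_row_fix.
Qed.

End RowSpecht.

Section TensorFunctionals.
Local Open Scope ring_scope.
Variables (F : fieldType) (H : finType) (D : Type) (d s : nat).
Variables (la : H -> 'M[F]_d) (ra : D -> 'M[F]_d).
Variables (chi : D -> F) (f : 'M[F]_(d, s)).
Hypotheses (la_f : forall h, la h *m f = f).
Hypotheses (ra_f : forall a, ra a *m f = chi a *: f).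

(** Sends [v (x) w] to [w *m f] times the sum of the entries of [v]. The dimension [k] stays general
    because [rdim M] equals 1 only propositionally. *)
Definition tensor_functional k : 'M[F]_(k * d, s) :=
  lin1_mx (mulmxr f \o mulmx (const_mx 1 : 'rV_k) \o vec_mx).

Lemma mxvec_tensor_functional k (x : 'M_(k, d)) :
  mxvec x *m tensor_functional k = const_mx 1 *m x *m f.
Proof. by rewrite mul_rV_lin1 /= mxvecK. Qed.

Lemma eq_mul_mxvec k m n (A B : 'M[F]_(m * n, k)) :
  (forall x, mxvec x *m A = mxvec x *m B) -> A = B.
Proof. by move=> AB; apply/row_matrixP=> i; rewrite !rowE -[delta_mx 0 i]vec_mxK AB. Qed.

Variable M : rmod F H.
Hypothesis trivM : forall h, ract M h = 1%:M.

Lemma balancing_tensor_functional : balancing M la *m tensor_functional (rdim M) = 0.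
Proof.
apply/eqP; rewrite -sub_kermx; apply/sumsmx_subP => h _; rewrite sub_kermx; apply/eqP.
apply: eq_mul_mxvec => x; rewrite mulmx0 mulmxBl mulmxBr !mulmxA !mul_vec_lin.
by rewrite !mxvec_tensor_functional /= trivM trmx1 mul1mx [const_mx 1 *m (x *m _)]mulmxA
   -(mulmxA _ (la h)) la_f subrr.
Qed.

Lemma intertwines_tensor_functional :
  intertwines chi (M := free_tensor M ra) (tensor_functional (rdim M)).
Proof.
move=> a; apply: eq_mul_mxvec => x; rewrite -scalemxAr mulmxA mul_vec_lin.
by rewrite !mxvec_tensor_functional /= -!mulmxA ra_f -!scalemxAr.
Qed.

Lemma tensor_functional_full : rdim M = 1%N -> row_full f ->
  row_full (tensor_functional (rdim M)).
Proof.
move=> -> /row_fullP[g gf]; apply/row_fullP.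
exists (\matrix_i mxvec (row i g)); apply/row_matrixP=> i.
rewrite row_mul rowK mxvec_tensor_functional.
have -> : const_mx 1 = 1%:M :> 'M[F]_1 by apply/matrixP=> ? ?; rewrite !ord1 !mxE.
by rewrite mul1mx -row_mul gf.
Qed.

Lemma mult_tensor_ge L : iso_rmod L (char_rmod chi) -> rdim M = 1%N -> row_full f ->
  (s <= mult (balanced_tensor M la ra) L)%N.
Proof.
move=> isoL dimM ffull; rewrite -(eqP (tensor_functional_full dimM ffull)).
apply: (mult_quot_ge isoL intertwines_tensor_functional).
exact: balancing_tensor_functional.
Qed.

End TensorFunctionals.

Section TensorCharacter.
Local Open Scope ring_scope.
Variables (F : fieldType) (H : finType) (D : Type) (d : nat).
Variables (la : H -> 'M[F]_d) (ra : D -> 'M[F]_d) (chi : D -> F) (M : rmod F H).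
Hypotheses (dimM : rdim M = 1%N) (trivM : forall h, ract M h = 1%:M).
Hypothesis la_sum : forall h, la h *m const_mx 1 = const_mx 1 :> 'cV_d.
Hypothesis ra_sum : forall a, ra a *m const_mx 1 = chi a *: const_mx 1 :> 'cV_d.
Variable j0 : 'I_d.
Hypothesis la_trans : forall j, exists h, delta_mx 0 j0 *m la h = delta_mx 0 j :> 'rV_d.

Lemma mxvec_diff_balancing j :
  (mxvec (const_mx 1 *m (delta_mx 0 j - delta_mx 0 j0 : 'rV_d)) <= balancing M la)%MS.
Proof.
have [h Dj] := la_trans j; apply: (submx_trans _ (sumsmx_sup h (erefl true) (submx_refl _))).
apply/submxP; exists (- mxvec (const_mx 1 *m (delta_mx 0 j0 : 'rV_d))).
rewrite /= mulNmx !mulmxBr !mul_vec_lin /= trivM trmx1 mul1mx -mulmxA Dj opprB.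
by rewrite linearB.
Qed.

(** The kernel of the coefficient sum is spanned by differences of basis vectors. As [H] acts
    transitively on the basis and trivially on [M], these are all balancing relations, so one
    dimension remains. *)
Lemma balanced_tensor_iso_char : iso_rmod (balanced_tensor M la ra) (char_rmod chi).
Proof.
have full1 : row_full (const_mx 1 : 'cV[F]_d).
  apply/row_fullP; exists (delta_mx 0 j0); apply/matrixP=> i j.
  by rewrite -rowE !ord1 !mxE.
apply: (@quot_iso_char _ _ _ (free_tensor M ra) _ (tensor_functional (const_mx 1) (rdim M))).
- rewrite -mxrank_eq0; have /eqP -> // := tensor_functional_full dimM full1.
- apply/rV_subP => v; rewrite sub_kermx -(vec_mxK v) mxvec_tensor_functional => /eqP.
  move: (vec_mx v) => x {v} x0; pose y : 'rV_d := const_mx 1 *m x.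
  have Dx : x = const_mx 1 *m y.
    rewrite /y mulmxA.
    have -> : (const_mx 1 : 'cV[F]_(rdim M)) *m (const_mx 1 : 'rV_(rdim M)) = 1%:M.
      apply/matrixP=> i j; rewrite !mxE big_ord1 !mxE mulr1.
      have ord_eq0 (k : 'I_(rdim M)) : k = 0%N :> nat.
        by have := leq_trans (ltn_ord k) (eq_leq dimM); case: (nat_of_ord k).
      by rewrite -val_eqE /= !ord_eq0.
    by rewrite mul1mx.
  have sum_y : \sum_j y 0 j = 0.
    have : (y *m const_mx 1 : 'M_1) 0 0 = 0 by rewrite /y x0 mxE.
    rewrite mxE => s0; rewrite -[RHS]s0; apply: eq_bigr => j _.
    by rewrite [const_mx _ _ _]mxE mulr1.
  have -> : x = (const_mx 1 : 'cV_(rdim M)) *m \sum_j y 0 j *: (delta_mx 0 j - delta_mx 0 j0).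
    rewrite Dx; congr (_ *m _); rewrite [LHS]row_sum_delta.
    under [RHS]eq_bigr do rewrite scalerBr.
    by rewrite sumrB -scaler_suml sum_y scale0r subr0.
  rewrite mulmx_sumr linear_sum; apply: summx_sub => j _.
  by rewrite -scalemxAr linearZ scalemx_sub // mxvec_diff_balancing.
- exact: balancing_tensor_functional.
- exact: intertwines_tensor_functional.
Qed.

End TensorCharacter.

(** * Stacking set-partitions *)

Section SameBlock.
Variable T : finType.
Implicit Types P Q : setpart T.

Definition same P : rel T := fun x y => pblock (val P) x == pblock (val P) y.

Lemma same_refl P x : same P x x. Proof. exact: eqxx. Qed.
Lemma same_sym P x y : same P x y = same P y x. Proof. exact: eq_sym. Qed.
Lemma same_trans P y x z : same P x y -> same P y z -> same P x z.
Proof. by move=> /eqP xy /eqP yz; apply/eqP/(etrans xy). Qed.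

Lemma mem_pblockE P x y : (y \in pblock (val P) x) = same P x y.
Proof.
have /and3P[/eqP covP trP _] := valP P.
by rewrite /same eq_pblock // covP inE.
Qed.

Lemma block_pblock P K x : K \in val P -> x \in K -> pblock (val P) x = K.
Proof. by have /and3P[_ trP _] := valP P; apply: def_pblock. Qed.

Lemma pblock_block P x : pblock (val P) x \in val P.
Proof.
by have /and3P[/eqP covP _ _] := valP P; apply: pblock_mem; rewrite covP inE.
Qed.

Lemma same_fibre (S : eqType) (f : T -> S) x y : 
  (y \in pblock (preim_partition f [set: T]) x) = (f x == f y).
Proof.
rewrite pblock_equivalence_partition ?inE //.
by split=> // /eqP->.
Qed.

Lemma setpart_eq P Q : same P =2 same Q -> P = Q.
Proof.
move=> PQ; apply: val_inj; rewrite /=.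
rewrite -(equivalence_partition_pblock (valP P)) -(equivalence_partition_pblock (valP Q)).
apply: eq_imset => x; apply/setP=> y; rewrite !inE /=.
by rewrite !mem_pblockE PQ.
Qed.

End SameBlock.

Lemma same_fibre_setpart (S T : finType) (f : S -> T) x y :
  same (fibre_setpart f) x y = (f x == f y).
Proof. by rewrite -mem_pblockE same_fibre. Qed.

Section StackTheory.
Variables (A B C : finType) (P : setpart (A + B)) (Q : setpart (B + C)).

Local Notation outer := (@emb_outer A B C).
Local Notation bottom := (@emb_bottom A B C).

Lemma stack_edgeP x y : reflect
  ((exists u v, [/\ x = inl u, y = inl v & same P u v])
   \/ (exists u v, [/\ x = bottom u, y = bottom v & same Q u v]))
  (stack_edge P Q x y).
Proof.
apply: (iffP orP) => -[].
- by case/existsP=> u /existsP[v /and3P[/eqP<- /eqP<- uv]]; left; exists u, v.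
- by case/existsP=> u /existsP[v /and3P[/eqP<- /eqP<- uv]]; right; exists u, v.
- case=> u [v [-> -> uv]]; left; apply/existsP; exists u; apply/existsP; exists v.
  by rewrite !eqxx.
- case=> u [v [-> -> uv]]; right; apply/existsP; exists u; apply/existsP; exists v.
  by rewrite !eqxx.
Qed.

Lemma stack_edge_sym : ssrbool.symmetric (stack_edge P Q).
Proof.
move=> x y; apply/stack_edgeP/stack_edgeP => -[] [u [v [-> -> uv]]];
by [left; exists v, u; rewrite same_sym | right; exists v, u; rewrite same_sym].
Qed.

Lemma same_stack x y :
  same (stack P Q) x y = connect (stack_edge P Q) (outer x) (outer y).
Proof.
rewrite same_fibre_setpart; have csym := sym_connect_sym stack_edge_sym.
apply/eqP/idP => [/setP/(_ (outer y))|xy]; first by rewrite !inE connect0.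
by apply/setP=> z; rewrite !inE (same_connect csym xy).
Qed.

(** A labelling constant on the blocks of [P] and of [Q] is constant on components; suitable
    labellings show that vertices of a stack are not joined. *)
Lemma stack_invariant (S : eqType) (f : A + B + C -> S) x y :
    (forall u v, same P u v -> f (inl u) = f (inl v)) ->
    (forall u v, same Q u v -> f (bottom u) = f (bottom v)) ->
  connect (stack_edge P Q) x y -> f x = f y.
Proof.
move=> fP fQ /connectP[p]; elim: p x => [|z p IHp] x /=; first by move=> _ ->.
case/andP=> /stack_edgeP xz /IHp /[apply] <-.
by case: xz => -[u [v [-> -> uv]]]; [apply: fP | apply: fQ].
Qed.

Lemma same_stack_bottom c c' :
  same Q (inr c) (inr c') -> same (stack P Q) (inr c) (inr c').
Proof.
move=> cc'; rewrite same_stack; apply/connect1/stack_edgeP; right.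
by exists (inr c), (inr c').
Qed.

(** A purely southern block of [Q] remains a block after stacking; the labelling [f] is its
    indicator function. *)
Lemma same_stack_nonpropagating c x : (forall b, ~~ same Q (inl b) (inr c)) ->
  same (stack P Q) (inr c) x -> exists2 c', x = inr c' & same Q (inr c) (inr c').
Proof.
move=> cN; pose f (z : A + B + C) := if z is inr c' then same Q (inr c) (inr c') else false.
rewrite same_stack => /(@stack_invariant _ f) f_inv.
have {f_inv} : f (outer (inr c)) = f (outer x).
  apply: f_inv => // -[b|c1] [b'|c2] //= same12.
  - apply/esym/negbTE/negP => cc2; case/negP: (cN b).
    by rewrite same_sym (same_trans cc2) // same_sym.
  - by apply/negbTE/negP => cc1; case/negP: (cN b'); rewrite same_sym (same_trans cc1).
  by apply/idP/idP => cc; apply: same_trans cc _; rewrite // same_sym.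
by rewrite /= same_refl; case: x => //= c' cc'; exists c'.
Qed.

End StackTheory.

(** * Permutation diagrams and their effect under stacking *)

Section PermutationDiagrams.
Variable r : nat.
Implicit Types (D : diagram r r) (s : {perm 'I_r}).

(** Only southern vertices are constrained, as these conditions pass easily through stacking; with
    [r] vertices on each side they force a bijection. *)
Definition is_perm_diagram D : bool :=
  [forall j, forall j', same D (inr j) (inr j') ==> (j == j')]
  && [forall j, [exists i, same D (inl i) (inr j)]].

Lemma perm_diagramP D : reflect
  ((forall j j', same D (inr j) (inr j') -> j = j')
   /\ (forall j, exists i, same D (inl i) (inr j))) (is_perm_diagram D).
Proof.
apply: (iffP andP) => -[D1 D2]; split.
- by move=> j j' jj'; apply/eqP; move/'forall_forallP/(_ j j')/implyP: D1; apply.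
- by move=> j; apply/existsP; apply/(forallP D2).
- by apply/'forall_forallP => j j'; apply/implyP=> /D1->.
- by apply/forallP=> j; apply/existsP.
Qed.

(* The northern vertex joined to a given vertex, when each southern vertex [j]
   is joined to the northern vertex [s j]. *)
Definition north_end s (x : 'I_r + 'I_r) : 'I_r :=
  match x with inl i => i | inr j => s j end.

Lemma perm_diagram_perm D : is_perm_diagram D ->
  exists s, forall x y, same D x y = (north_end s x == north_end s y).
Proof.
case/perm_diagramP=> Dinj /fin_all_exists[f fP].
have f_inj : injective f.
  by move=> j j' eqf; apply: Dinj; rewrite (same_trans _ (fP j')) // -eqf same_sym.
pose s := perm f_inj; exists s => x y.
have repr z : same D z (inr ((s^-1)%g (north_end s z))).
  case: z => [i|j] /=; last by rewrite permK same_refl.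
  by have := fP ((s^-1)%g i); rewrite -[f _](permE f_inj) permKV.
have -> : same D x y =
    same D (inr ((s^-1)%g (north_end s x))) (inr ((s^-1)%g (north_end s y))).
  apply/idP/idP => xy.
    by apply: same_trans (same_trans xy (repr y)); rewrite same_sym.
  by apply: same_trans (same_trans (repr x) xy) _; rewrite same_sym.
apply/idP/eqP => [/Dinj/perm_inj // | ->]; exact: same_refl.
Qed.

Lemma perm_fibre_diagram s : is_perm_diagram (fibre_setpart (north_end s)).
Proof.
apply/perm_diagramP; split=> [j j'|j]; first by rewrite same_fibre_setpart => /eqP/perm_inj.
by exists (s j); rewrite same_fibre_setpart.
Qed.

(** Each propagating block contains a southern vertex, so [r] such blocks use up the southern
    vertices, one each. *)
Lemma mem_V_basis D : (D \in V_basis r r) = is_perm_diagram D.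
Proof.
rewrite inE; pose south j := pblock (val D) (inr j : 'I_r + 'I_r).
pose prop := [set K in val D | propagating K].
have sub_south : prop \subset south @: 'I_r.
  apply/subsetP=> K; rewrite inE => /andP[DK /andP[_ /existsP[j Kj]]].
  by apply/imsetP; exists j; rewrite // /south (block_pblock DK Kj).
rewrite -/prop; apply/eqP/perm_diagramP => [card_prop | [Dinj Dnorth]].
  have card_south : #|south @: 'I_r| = r.
    apply/eqP; rewrite eqn_leq; apply/andP; split.
      by rewrite -[leqRHS]card_ord leq_imset_card.
    by rewrite -[leqLHS]card_prop subset_leq_card.
  have /eqP eq_prop : prop == south @: 'I_r.
    by rewrite eqEcard sub_south card_south card_prop /=.
  have /imset_injP south_inj : #|south @: 'I_r| == #|'I_r| by rewrite card_south card_ord.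
  split=> [j j' /eqP jj'|j]; first exact: south_inj.
  have : south j \in prop by rewrite eq_prop imset_f.
  rewrite inE => /andP[_ /andP[/existsP[i +] _]]; rewrite mem_pblockE => ij.
  by exists i; rewrite same_sym.
have -> : prop = south @: 'I_r.
  apply/eqP; rewrite eqEsubset sub_south; apply/subsetP=> K /imsetP[j _ ->].
  rewrite inE pblock_block /=; have [i ij] := Dnorth j.
  apply/andP; split; apply/existsP; [exists i | exists j].
    by rewrite mem_pblockE same_sym.
  by rewrite mem_pblockE same_refl.
by rewrite card_imset ?card_ord // => j j' /eqP/Dinj.
Qed.

(** A permutation diagram renames the southern vertices by [s], and every middle vertex is joined to
    a southern one, so nothing is deleted. *)
Lemma same_stack_perm b (L : diagram b r) D s :
    (forall x y, same D x y = (north_end s x == north_end s y)) ->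
  let f (x : 'I_b + 'I_r) := match x with inl i => inl i | inr j => inr (s j) end in
  (forall x y, same (stack L D) x y = same L (f x) (f y)) /\ deleted L D = 0.
Proof.
move=> Ds f; have csym := sym_connect_sym (stack_edge_sym L D).
have toL x : connect (stack_edge L D) (emb_outer 'I_r x) (inl (f x)).
  case: x => [i|j] /=; first exact: connect0.
  apply/connect1/stack_edgeP; right; exists (inr j), (inl (s j)).
  by rewrite Ds eqxx.
split=> [x y|].
  rewrite same_stack; pose g (z : 'I_b + 'I_r + 'I_r) :=
    match z with inl z => pblock (val L) z | inr j => pblock (val L) (inr (s j)) end.
  apply/idP/idP => [/(@stack_invariant _ _ _ _ _ _ g) xy | xy].
    have {xy} : g (emb_outer 'I_r x) = g (emb_outer 'I_r y).
      apply: xy => [u v /eqP // | u v]; rewrite Ds => /eqP uv.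
      by case: u v uv => [i|j] [i'|j'] /= ->.
    by case: x y => [i|j] [i'|j'] /= xy; apply/eqP.
  apply: connect_trans (toL x) _; rewrite csym; apply: connect_trans (toL y) _.
  by rewrite csym; apply/connect1/stack_edgeP; left; exists (f x), (f y).
apply: eq_card0 => K; rewrite !inE; apply/negbTE/negP=> /andP[/imsetP[z _ ->]].
move=> /subsetP sub_mid; have : z \in component L D z by rewrite inE connect0.
move/sub_mid/imsetP=> [u _ Dz]; have := sub_mid (inr ((s^-1)%g u)).
rewrite inE Dz csym; have := toL (inr ((s^-1)%g u)); rewrite /= permKV => -> /(_ isT).
by case/imsetP.
Qed.

Lemma stack_perm_diagram (L D : diagram r r) : is_perm_diagram (stack L D) -> is_perm_diagram D.
Proof.
case/perm_diagramP=> LDinj LDnorth; apply/perm_diagramP; split=> [j j' jj'|j].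
  exact/LDinj/same_stack_bottom.
apply/existsP; apply: contraT; rewrite negb_exists => /forallP jN.
by case: (LDnorth j) => i; rewrite same_sym => /(same_stack_nonpropagating (P := L) jN)[].
Qed.

End PermutationDiagrams.

(** * The simple module of a one-row partition *)

Section MonomialMatrices.
Local Open Scope ring_scope.
Variables (F : fieldType) (T : finType) (A : {set T}).

Definition table s (phi : T -> 'I_s -> F) : 'M[F]_(#|A|, s) :=
  \matrix_(i, k) phi (enum_val i) k.

Lemma monomial_mx_table s f w (phi : T -> 'I_s -> F) c :
    (forall x k, x \in A ->
       (if f x \in A then w x * phi (f x) k else 0) = c * phi x k) ->
  monomial_mx A f w *m table phi = c *: table phi.
Proof.
move=> fphi; apply/matrixP=> i k; rewrite !mxE -fphi ?enum_valP //.
set x := enum_val i; case: ifPn => fxA.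
  rewrite (bigD1 (enum_rank_in fxA (f x))) //= big1 ?addr0.
    by rewrite !mxE enum_rankK_in // eqxx.
  move=> j neq_j; rewrite !mxE; case: eqP => [fxj|_]; last by rewrite mul0r.
  by case/eqP: neq_j; apply: enum_val_inj; rewrite enum_rankK_in.
rewrite big1 // => j _; rewrite !mxE; case: eqP => [fxj|_]; last by rewrite mul0r.
by rewrite fxj enum_valP in fxA.
Qed.

Lemma delta_monomial_mx f (i j : 'I_#|A|) : f (enum_val i) = enum_val j ->
  delta_mx 0 i *m monomial_mx A f (fun=> 1) = delta_mx 0 j :> 'rV[F]_#|A|.
Proof.
move=> fij; rewrite -rowE; apply/rowP=> k; rewrite !mxE fij eqxx /=.
by rewrite (inj_eq enum_val_inj) eq_sym; case: eqP.
Qed.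

End MonomialMatrices.

Section StandardModule.
Local Open Scope ring_scope.
Variables (F : fieldType) (r : nat).

Definition perm_char (D : diagram r r) : F := (is_perm_diagram D)%:R.

Lemma same_permute_north b (s : {perm 'I_b}) (L : diagram b r) x y :
  let f (x : 'I_b + 'I_r) := match x with inl i => inl (s i) | inr j => inr j end in
  same (permute_north s L) x y = same L (f x) (f y).
Proof. by move=> f; rewrite same_fibre_setpart. Qed.

Lemma is_perm_permute_north s D :
  is_perm_diagram D -> is_perm_diagram (permute_north s D : diagram r r).
Proof.
case/perm_diagramP=> Dinj Dnorth; apply/perm_diagramP; split=> [j j'|j].
  by rewrite same_permute_north => /Dinj.
have [i ij] := Dnorth j; exists ((s^-1)%g i).
by rewrite same_permute_north permKV.
Qed.

(** For [k = r] the basis consists of the permutation diagrams, on which the symmetric group is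
    transitive, so tensoring with the trivial module leaves one dimension. The equation [k = r] is a
    hypothesis because [k] will be [sumn (row_partition r)]. *)
Lemma standard_module_iso_char (delta : F) k (M : rmod F {perm 'I_k}) :
    k = r -> rdim M = 1%N -> (forall h, ract M h = 1%:M) ->
  iso_rmod (balanced_tensor M
      (fun s => monomial_mx (V_basis k r) (permute_north s) (fun=> 1))
      (fun D => monomial_mx (V_basis k r) (fun L => stack L D)
                  (fun L => delta ^+ deleted L D)))
    (char_rmod perm_char).
Proof.
move=> Dk; subst k => dimM trivM.
have const1 : const_mx 1 = table (V_basis r r) (fun _ _ => 1) :> 'cV[F]_#|V_basis r r|.
  by apply/matrixP=> i j; rewrite !mxE.
pose L0 := fibre_setpart (north_end 1%g) : diagram r r.
have VL0 : L0 \in V_basis r r by rewrite mem_V_basis perm_fibre_diagram.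
apply: (balanced_tensor_iso_char dimM trivM _ _ (j0 := enum_rank_in VL0 L0)).
- move=> s; rewrite const1 (monomial_mx_table (c := 1)) ?scale1r // => D _ VD.
  by rewrite !mem_V_basis in VD *; rewrite is_perm_permute_north // mulr1.
- move=> D; rewrite const1 (monomial_mx_table (c := perm_char D)) // => L _ VL.
  rewrite mem_V_basis !mulr1 /perm_char; case: ifPn => [/stack_perm_diagram DP|].
    have [s sP] := perm_diagram_perm DP.
    by rewrite DP (same_stack_perm L sP).2 expr0.
  case DP: (is_perm_diagram D) => //; case/negP.
  have [s sP] := perm_diagram_perm DP; have [LE _] := same_stack_perm L sP.
  move: VL; rewrite mem_V_basis => /perm_diagramP[Linj Lnorth].
  apply/perm_diagramP; split=> [j j'|j]; first by rewrite LE => /Linj/perm_inj.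
  by have [i ij] := Lnorth (s j); exists i; rewrite LE.
move=> j; have := enum_valP j; rewrite mem_V_basis => /perm_diagram_perm[s sP].
exists (s^-1)%g; apply: delta_monomial_mx; rewrite enum_rankK_in //.
apply: setpart_eq => x y; rewrite same_permute_north same_fibre_setpart sP.
by case: x y => [i|i] [i'|i'] /=; rewrite ?perm1 -(inj_eq (@perm_inj _ s)) ?permKV.
Qed.

End StandardModule.

(** * Types of ramified diagrams *)

Section OuterTypes.
Variables b r : nat.
Implicit Types (L : diagram b r) (X : diagram b r * diagram b r).

Definition south_separated L : bool :=
  [forall j, forall j', same L (inr j) (inr j') ==> (j == j')].

Definition south_size L (j : 'I_r) := #|[set j' | same L (inr j) (inr j')]|.

Definition marked L (j : 'I_r) : bool := [exists i, same L (inl i) (inr j)].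

(** Vertices are counted, not blocks, so a block with [n] southern vertices contributes [n]. At
    [n = 0] the count is 0, which hides the zeros that pad a type. *)
Definition type_count L n (mk : bool) : nat :=
  #|[set j | (south_size L j == n) && (marked L j == mk)]|.

(* A pair [(u, v)] lists the sizes of the unmarked and of the marked blocks. *)
Definition has_type X (t : seq nat * seq nat) : bool :=
  south_separated X.1
  && [forall n : 'I_r.+1, forall mk : bool,
        type_count X.2 n mk == n * count_mem (val n) (if mk then t.2 else t.1)].

Definition relabel (s : {perm 'I_b}) (s' : {perm 'I_r}) (x : 'I_b + 'I_r) :=
  match x with inl i => inl (s i) | inr j => inr (s' j) end.

Definition relabelled s s' L L' :=
  forall x y, same L' x y = same L (relabel s s' x) (relabel s s' y).

Lemma mem_V0_basis X : reflect
  ((forall x y, same X.1 x y -> same X.2 x y)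
   /\ forall i, [/\ forall y, same X.1 (inl i) y -> y = inl i,
                    exists j, same X.2 (inl i) (inr j)
                  & forall i', same X.2 (inl i) (inl i') -> i' = i])
  (X \in V0_basis b r).
Proof.
rewrite inE; apply: (iffP andP) => -[].
  move=> /'forall_implyP ref /forallP XP; split=> [x y xy|i].
    have /exists_inP[K XK subK] := ref _ (pblock_block X.1 x).
    have Kx : x \in K by rewrite (subsetP subK) // mem_pblockE same_refl.
    have Ky : y \in K by rewrite (subsetP subK) // mem_pblockE.
    by rewrite /same (block_pblock XK Kx) (block_pblock XK Ky).
  have /andP[X1 /exists_inP[K XK /and3P[Ki /existsP[j Kj] /forallP Ki']]] := XP i.
  have EK := block_pblock XK Ki; split.
  - move=> y; rewrite -mem_pblockE (block_pblock X1) ?inE // => /eqP //.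
  - by exists j; rewrite -mem_pblockE EK.
  - by move=> i'; rewrite -mem_pblockE EK => iK; apply/eqP/(implyP (Ki' i')).
move=> ref XP; split.
  apply/'forall_implyP => K XK; have /set0Pn[x Kx] : K != set0.
    by have /and3P[_ _] := valP X.1; apply: contraNneq => <-.
  apply/exists_inP; exists (pblock (val X.2) x); first exact: pblock_block.
  by apply/subsetP=> y; rewrite -(block_pblock XK Kx) !mem_pblockE; apply: ref.
apply/forallP=> i; have [X1 [j ij] Xi] := XP i; apply/andP; split.
  have <- : pblock (val X.1) (inl i) = [set inl i]; last exact: pblock_block.
  apply/setP=> y; rewrite mem_pblockE inE.
  by apply/idP/eqP => [/X1//|->]; apply: same_refl.
apply/exists_inP; exists (pblock (val X.2) (inl i)); first exact: pblock_block.
rewrite mem_pblockE same_refl /=; apply/andP; split.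
  by apply/existsP; exists j; rewrite mem_pblockE.
by apply/forallP=> i'; apply/implyP; rewrite mem_pblockE => /Xi->.
Qed.

Section Relabelling.
Variables (s : {perm 'I_b}) (s' : {perm 'I_r}).

Lemma relabel_inj : injective (relabel s s').
Proof. by case=> [i|j] [i'|j'] //= [/perm_inj->]. Qed.

Lemma south_separated_relabel L L' : relabelled s s' L L' ->
  south_separated L' = south_separated L.
Proof.
move=> LL'; apply/'forall_forallP/'forall_forallP => sep j j'; apply/implyP.
  have := sep ((s'^-1)%g j) ((s'^-1)%g j'); rewrite LL' /= !permKV => /implyP sepj /sepj.
  by rewrite (inj_eq perm_inj).
by rewrite LL' -(inj_eq (@perm_inj _ s')) => /(implyP (sep _ _)).
Qed.

Lemma type_count_relabel L L' n mk : relabelled s s' L L' ->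
  type_count L' n mk = type_count L n mk.
Proof.
move=> LL'.
have sz j : south_size L' j = south_size L (s' j).
  rewrite /south_size -[RHS](card_preimset _ (@perm_inj _ s')); apply: eq_card => j'.
  by rewrite !inE LL'.
have mkE j : marked L' j = marked L (s' j).
  apply/existsP/existsP => -[i ij]; first by exists (s i); rewrite LL' in ij.
  by exists ((s^-1)%g i); rewrite LL' /= permKV.
rewrite /type_count -[RHS](card_preimset _ (@perm_inj _ s')); apply: eq_card => j.
by rewrite !inE sz mkE.
Qed.

Lemma has_type_relabel X X' t : relabelled s s' X.1 X'.1 -> relabelled s s' X.2 X'.2 ->
  has_type X' t = has_type X t.
Proof.
move=> rel1 rel2; rewrite /has_type (south_separated_relabel rel1); congr (_ && _).
apply: eq_forallb => n; apply: eq_forallb => mk.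
by rewrite (type_count_relabel _ _ rel2).
Qed.

Lemma V0_relabel X X' : relabelled s s' X.1 X'.1 -> relabelled s s' X.2 X'.2 ->
  X \in V0_basis b r -> X' \in V0_basis b r.
Proof.
move=> rel1 rel2 /mem_V0_basis[ref XP]; apply/mem_V0_basis; split=> [x y|i].
  by rewrite rel1 rel2; apply: ref.
have [X1 [j ij] Xi] := XP (s i); split.
- by move=> y; rewrite rel1 => /X1 eqy; apply: relabel_inj.
- by exists ((s'^-1)%g j); rewrite rel2 /= permKV.
by move=> i'; rewrite rel2 => /Xi/perm_inj.
Qed.

End Relabelling.

(** Separated inner blocks force the southern vertices of [D] apart. One of them joined to no
    northern vertex of [D] would become an unmarked outer block of size 1, which the type
    excludes. *)
Lemma has_type_stack X (D : diagram r r) t : (0 < r)%N -> 1 \notin t.1 ->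
  has_type (stack X.1 D, stack X.2 D) t -> is_perm_diagram D.
Proof.
move=> r_gt0 t1 /andP[/'forall_forallP sep /'forall_forallP tP].
have Dinj j j' : same D (inr j) (inr j') -> j = j'.
  by move=> jj'; apply/eqP/(implyP (sep j j'))/same_stack_bottom.
apply/perm_diagramP; split=> // j; apply/existsP; apply: contraT.
rewrite negb_exists => /forallP jN.
have lt1 : 1 < r.+1 by [].
have := tP (Ordinal lt1) false; rewrite /= mul1n (count_memPn t1) => /eqP/card0_eq/(_ j).
have size1 : south_size (stack X.2 D) j = 1.
  apply/eqP/cards1P; exists j; apply/setP=> j'; rewrite !inE.
  apply/idP/eqP => [|->]; last exact: same_refl.
  by move=> /(same_stack_nonpropagating jN)[_ [<-] /Dinj].
rewrite !inE size1 eqxx eqbF_neg /= => /negbFE/existsP[i ij].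
by move: ij; rewrite same_sym => /(same_stack_nonpropagating jN)[].
Qed.

End OuterTypes.

Lemma row_full_table (F : fieldType) (T : finType) (A : {set T}) s (phi : T -> 'I_s -> F)
    (x : 'I_s -> T) :
    (forall k, x k \in A) -> (forall k l, phi (x k) l = (k == l)%:R)%R ->
  row_full (table A phi).
Proof.
move=> xA phix; apply/row_fullP.
exists (\matrix_k delta_mx 0 (enum_rank_in (xA k) (x k)))%R.
apply/row_matrixP=> k; rewrite row_mul rowK -rowE row1; apply/rowP=> l.
by rewrite !mxE enum_rankK_in // phix eqxx eq_sym.
Qed.

(** * Indicator functions of types as functionals on the ramified diagrams *)

Section RamifiedMultiplicity.
Local Open Scope ring_scope.
Variables (F : fieldType) (b r : nat).
Hypothesis r_gt0 : (0 < r)%N.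

Variable ts : seq (seq nat * seq nat).

Definition type_functional (X : diagram b r * diagram b r) (k : 'I_(size ts)) : F :=
  (has_type X (tnth (in_tuple ts) k))%:R.

Lemma type_functional_north h :
  monomial_mx (V0_basis b r)
      (fun X => (permute_north h X.1, permute_north h X.2)) (fun=> 1)
    *m table (V0_basis b r) type_functional = table (V0_basis b r) type_functional.
Proof.
rewrite (monomial_mx_table (c := 1)) ?scale1r // => X k VX.
have rel (L : diagram b r) : relabelled h 1 L (permute_north h L).
  by move=> x y; rewrite same_permute_north; case: x y => [x|x] [y|y] //=; rewrite !perm1.
pose X' := (permute_north h X.1, permute_north h X.2).
have VX' : X' \in V0_basis b r := V0_relabel (X' := X') (rel X.1) (rel X.2) VX.
have typeX' t := has_type_relabel (X' := X') t (rel X.1) (rel X.2).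
by rewrite VX' !mul1r /type_functional typeX'.
Qed.

(** Permutation diagrams relabel and delete nothing, so their scalars are 1 whatever [m] and [n]
    are; after any other diagram no result has one of the types, by [has_type_stack]. *)
Lemma type_functional_south (m n : F) (D : diagram r r) :
    {in ts, forall t, 1%N \notin t.1} ->
  monomial_mx (V0_basis b r)
      (fun X => (stack X.1 D, stack X.2 D))
      (fun X => m ^+ deleted X.1 D * n ^+ deleted X.2 D)
    *m table (V0_basis b r) type_functional
  = perm_char F D *: table (V0_basis b r) type_functional.
Proof.
move=> ts1; rewrite (monomial_mx_table (c := perm_char F D)) // => X k VX.
rewrite /perm_char; case: (boolP (is_perm_diagram D)) => [DP | notDP].
  have [s sP] := perm_diagram_perm DP.
  have rel (L : diagram b r) : relabelled 1 s L (stack L D).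
    move=> x y; rewrite (same_stack_perm L sP).1.
    by case: x y => [x|x] [y|y] //=; rewrite !perm1.
  pose X' := (stack X.1 D, stack X.2 D).
  have VX' : X' \in V0_basis b r := V0_relabel (X' := X') (rel X.1) (rel X.2) VX.
  have typeX' t := has_type_relabel (X' := X') t (rel X.1) (rel X.2).
  rewrite VX' /type_functional typeX'.
  by rewrite (same_stack_perm X.1 sP).2 (same_stack_perm X.2 sP).2 !mul1r.
rewrite mul0r; case: ifP => // _; rewrite /type_functional.
case: (boolP (has_type _ _)) => [/has_type_stack DP|]; last by rewrite mulr0.
by rewrite DP // in notDP; apply: ts1; apply: mem_tnth.
Qed.

End RamifiedMultiplicity.

(** * A ramified diagram of each type *)

Section Realization.

Definition block_word (sh : seq nat) : seq nat :=
  flatten [seq nseq (nth 0 sh k) k | k <- iota 0 (size sh)].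

Lemma count_block_word a sh :
  count a (block_word sh) = \sum_(0 <= k < size sh | a k) nth 0 sh k.
Proof.
rewrite /block_word count_flatten -map_comp sumnE big_map /index_iota subn0.
rewrite [RHS]big_mkcond; apply: eq_bigr => k _.
by rewrite /= count_nseq; case: (a k); rewrite ?mul1n.
Qed.

Lemma size_block_word sh : size (block_word sh) = sumn sh.
Proof. by rewrite -count_predT count_block_word sumnE [RHS](big_nth 0). Qed.

Lemma block_word_lt sh x : x \in block_word sh -> x < size sh.
Proof.
case/flattenP => _ /mapP[k + ->] /nseqP[-> _].
by rewrite mem_iota.
Qed.

Lemma count_mem_block_word sh k : count_mem k (block_word sh) = nth 0 sh k.
Proof.
rewrite count_block_word big_mkord; have [ltk|lek] := ltnP k (size sh).
  by rewrite (big_pred1 (Ordinal ltk)).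
rewrite nth_default // big_pred0 // => i; apply/negbTE.
by rewrite neq_ltn (leq_trans (ltn_ord i)).
Qed.

Lemma card_nth a r (w : seq nat) : size w = r ->
  #|[set j : 'I_r | a (nth 0 w j)]| = count a w.
Proof.
move=> <-; rewrite -sum1_count (big_nth 0) big_mkord -sum1_card.
by apply: eq_bigl => j; rewrite inE.
Qed.

Lemma sum_nth_eq n (w : seq nat) :
  \sum_(0 <= k < size w | nth 0 w k == n) nth 0 w k = n * count_mem n w.
Proof.
rewrite -(big_nth 0 (fun x => x == n) id) -sum1_count big_distrr /=.
by apply: eq_bigr => x /eqP->; rewrite muln1.
Qed.

Variables (b r : nat) (u v : seq nat).
Hypotheses (size_v : size v = b) (v_gt0 : 0 \notin v) (size_u : size u = r).
Hypothesis sum_uv : sumn u + sumn v = r.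

Let sh := v ++ u.
Let w := block_word sh.

Let size_w : size w = r.
Proof. by rewrite size_block_word sumn_cat addnC. Qed.

(** Label [i < b] names the marked block of northern vertex [i]; labels from [b] on name unmarked
    blocks, and a padding zero names an empty one. The successor in the ordinal type is what [inord]
    requires. *)
Definition realization_label (x : 'I_b + 'I_r) : 'I_(b + r).+1 :=
  match x with inl i => inord i | inr j => inord (nth 0 w j) end.

Definition realization : diagram b r * diagram b r :=
  (fibre_setpart id, fibre_setpart realization_label).

Let lt_w j : j < r -> nth 0 w j < (b + r).+1.
Proof.
move=> ltj; have /block_word_lt : nth 0 w j \in w by rewrite mem_nth ?size_w.
by rewrite size_cat size_v size_u => /leqW.
Qed.

Let same_ss (j j' : 'I_r) :
  same realization.2 (inr j) (inr j') = (nth 0 w j == nth 0 w j').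
Proof. by rewrite same_fibre_setpart -val_eqE /= !inordK ?lt_w. Qed.

Let lt_n (i : 'I_b) : i < (b + r).+1.
Proof. by apply: leqW; apply: leq_trans (ltn_ord i) (leq_addr _ _). Qed.

Let same_ns (i : 'I_b) (j : 'I_r) :
  same realization.2 (inl i) (inr j) = (val i == nth 0 w j).
Proof. by rewrite same_fibre_setpart -val_eqE /= !inordK ?lt_w ?lt_n. Qed.

Lemma realization_V0 : realization \in V0_basis b r.
Proof.
apply/mem_V0_basis; split=> [x y|i].
  by rewrite same_fibre_setpart => /eqP->; apply: same_refl.
split.
- by move=> y; rewrite same_fibre_setpart => /eqP.
- have : val i \in w.
    rewrite -has_pred1 has_count count_mem_block_word nth_cat size_v ltn_ord /= lt0n.
    by apply: contraNneq v_gt0 => v0; rewrite -[X in X \in _]v0 mem_nth ?size_v.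
  move/(nthP 0) => [j]; rewrite size_w => ltj Dj; exists (Ordinal ltj).
  by rewrite same_ns /= Dj.
- move=> i'; rewrite same_fibre_setpart -val_eqE /= !inordK ?lt_n // => /eqP ii'.
  exact/esym/val_inj.
Qed.

Lemma realization_type : has_type realization (u, v).
Proof.
apply/andP; split.
  by apply/'forall_forallP => j j'; apply/implyP; rewrite same_fibre_setpart => /eqP[->].
apply/'forall_forallP => n mk; apply/eqP => /=.
have szE (j : 'I_r) : south_size realization.2 j = nth 0 sh (nth 0 w j).
  rewrite -count_mem_block_word -(card_nth _ size_w); apply: eq_card => j'.
  by rewrite !inE same_ss eq_sym.
have mkE (j : 'I_r) : marked realization.2 j = (nth 0 w j < b).
  apply/existsP/idP => [[i ij]|ltb].
    by rewrite same_ns in ij; rewrite -(eqP ij) ltn_ord.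
  by exists (Ordinal ltb); rewrite same_ns.
transitivity (count (fun k => (nth 0 sh k == n) && ((k < b) == mk)) w).
  rewrite -(card_nth _ size_w); apply: eq_card => j.
  by rewrite !inE szE mkE.
(* Splitting the labels at [b] separates the marked blocks from the unmarked ones. *)
rewrite count_block_word size_cat size_v size_u (big_cat_nat (n := b)) ?leq_addr //=.
have -> : \sum_(0 <= k < b | (nth 0 sh k == n) && ((k < b) == mk)) nth 0 sh k
    = mk * (n * count_mem (val n) v).
  rewrite -sum_nth_eq size_v !big_mkord big_distrr /= big_mkcond [RHS]big_mkcond.
  apply: eq_bigr => k _; rewrite nth_cat size_v ltn_ord.
  by case: mk; rewrite ?andbT ?andbF ?mul1n //; case: ifP.
have -> : \sum_(b <= k < b + r | (nth 0 sh k == n) && ((k < b) == mk)) nth 0 sh k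
    = ~~ mk * (n * count_mem (val n) u).
  rewrite -{1}[b]add0n big_addn addKn -sum_nth_eq size_u !big_mkord big_distrr /=.
  rewrite big_mkcond [RHS]big_mkcond; apply: eq_bigr => k _.
  rewrite nth_cat size_v addnK ltnNge leq_addl /=.
  by case: mk; rewrite ?andbT ?andbF ?mul1n //; case: ifP.
by case: mk; rewrite ?mul1n ?addn0.
Qed.

End Realization.

Section StableTypes.
Variables b r : nat.
Hypothesis r_gt0 : 0 < r.
Implicit Types t : seq nat * seq nat.

Lemma mem_mwords_nat a al (u : seq nat) : sorted ltn al ->
  (u \in mwords a al) = [&& size u == a, sorted leq u & all (mem al) u].
Proof.
rewrite (sorted_pairwise ltn_trans) => al_sorted.
apply: mem_mwords => //; [exact: leq_total | exact: leq_trans |].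
by apply: sub_pairwise al_sorted => x y; rewrite -ltnNge.
Qed.

Lemma stable_typesP t : t \in stable_types b r ->
  [/\ size t.1 = r /\ size t.2 = b, sorted leq t.1 /\ sorted leq t.2,
      1 \notin t.1 /\ 0 \notin t.2, all (geq r) t.1 /\ all (geq r) t.2
    & sumn t.1 + sumn t.2 = r].
Proof.
rewrite mem_filter => /andP[/eqP sum_t /allpairsP[[u v] [/= uw vw Dt]]].
rewrite Dt /= in sum_t *.
have sorted1 : sorted ltn (0 :: iota 2 r.-1).
  by case: (r.-1) => // n; exact: (iota_ltn_sorted 2 n.+1).
have sorted2 := iota_ltn_sorted 1 r.
move: uw vw; rewrite !mem_mwords_nat // => /and3P[/eqP-> -> /allP uA] /and3P[/eqP-> -> /allP vA].
split=> //.
  split; apply/negP; [move/uA | move/vA]; rewrite /= ?inE mem_iota //.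
by split; apply/allP=> x; [move/uA | move/vA]; rewrite /= ?inE mem_iota; lia.
Qed.

(** The multiplicity of 0, invisible to [has_type], follows from the common length. *)
Lemma perm_count_gt0 (u u' : seq nat) : size u = size u' ->
  (forall x, 0 < x -> count_mem x u = count_mem x u') -> perm_eq u u'.
Proof.
move=> szu eqc; have perm0 : perm_eq [seq x <- u | x != 0] [seq x <- u' | x != 0].
  apply/allP => x _ /=; rewrite !count_filter; apply/eqP.
  case: x => [|x]; first by rewrite !(@eq_count _ _ pred0) ?count_pred0 // => -[].
  rewrite !(@eq_count _ (predI (pred1 x.+1) (fun x => x != 0)) (pred1 x.+1)) ?eqc //.
    by move=> y /=; case: eqP => // ->.
  by move=> y /=; case: eqP => // ->.
apply/allP => -[|x] _; apply/eqP; last exact: eqc.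
have := perm_size perm0; rewrite !size_filter.
have := count_predC (pred1 0) u; have := count_predC (pred1 0) u'.
move=> count_u' count_u eq_neq0; apply: (@addIn (count (predC (pred1 0)) u')).
by rewrite count_u' -szu -count_u; congr (_ + _).
Qed.

Lemma has_type_inj (X : diagram b r * diagram b r) t t' :
  t \in stable_types b r -> t' \in stable_types b r ->
  has_type X t -> has_type X t' -> t = t'.
Proof.
case: t t' => [u v] [u' v'].
move=> /stable_typesP[/= [su sv] [lu lv] _ [ru rv] _].
move=> /stable_typesP[/= [su' sv'] [lu' lv'] _ [ru' rv'] _].
move=> /andP[_ /'forall_forallP tP] /andP[_ /'forall_forallP tP'].
have absent x l : all (geq r) l -> r < x -> count_mem x l = 0.
  by move=> /allP rl ltrx; apply/count_memPn/negP => /rl /=; rewrite leqNgt ltrx.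
have eq_cnt mk x : 0 < x ->
    count_mem x (if mk then v else u) = count_mem x (if mk then v' else u').
  move=> x_gt0; have [lexr|ltrx] := leqP x r; last by case: mk; rewrite !absent.
  have lt_xr : x < r.+1 by [].
  have /eqP := tP' (Ordinal lt_xr) mk; rewrite (eqP (tP (Ordinal lt_xr) mk)) /=.
  by move/eqP; rewrite eqn_pmul2l // => /eqP.
congr (_, _); apply: (sorted_eq leq_trans anti_leq) => //.
  by apply: perm_count_gt0; [rewrite su su' | exact: (eq_cnt false)].
by apply: perm_count_gt0; [rewrite sv sv' | exact: (eq_cnt true)].
Qed.

Lemma stable_types_uniq : uniq (stable_types b r).
Proof.
apply: filter_uniq; apply: allpairs_uniq; rewrite ?mwords_uniq ?iota_uniq //.
  by rewrite /= mem_iota iota_uniq.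
by move=> [? ?] [? ?].
Qed.

End StableTypes.

Section RamifiedBound.
Local Open Scope ring_scope.
Variables (F : fieldType) (b r : nat).
Hypothesis r_gt0 : (0 < r)%N.

(** Each type is realised, and no diagram has two types, so the functionals take the values of an
    identity matrix on the realisations. *)
Lemma type_functional_full : row_full
  (table (V0_basis b r) (@type_functional F b r (stable_types b r))).
Proof.
pose t (k : 'I_(size (stable_types b r))) := tnth (in_tuple (stable_types b r)) k.
have tS k : t k \in stable_types b r by apply: mem_tnth.
have real k : has_type (realization b r (t k).1 (t k).2) (t k).
  have [[su sv] _ [_ v0] _ sum_t] := stable_typesP r_gt0 (tS k).
  by case: (t k) su sv v0 sum_t => u v /= *; apply: realization_type.
apply: (@row_full_table _ _ _ _ _ (fun k => realization b r (t k).1 (t k).2)).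
  move=> k; have [[su sv] _ [_ v0] _ sum_t] := stable_typesP r_gt0 (tS k).
  exact: realization_V0.
move=> k l; rewrite /type_functional -/(t l); congr (nat_of_bool _)%:R.
apply/idP/eqP => [typ|<-]; last exact: real.
have /eqP := has_type_inj r_gt0 (tS k) (tS l) (real k) typ.
rewrite /t !(tnth_nth ([::], [::])) /= nth_uniq ?ltn_ord ?stable_types_uniq //.
by move/eqP/val_inj.
Qed.

Lemma ramified_tensor_mult_ge (m n : F) L (M : rmod F {perm 'I_b}) :
    rdim M = 1%N -> (forall h, ract M h = 1%:M) ->
    iso_rmod L (char_rmod (@perm_char F r)) ->
  (size (stable_types b r) <= mult (pull_rmod (@diag_ramified r r)
     (balanced_tensor M
        (fun s => monomial_mx (V0_basis b r)
                    (fun X => (permute_north s X.1, permute_north s X.2)) (fun=> 1%R))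
        (fun D : ramified r r => monomial_mx (V0_basis b r)
           (fun X => (stack X.1 (val D).1, stack X.2 (val D).2))
           (fun X => (m ^+ deleted X.1 (val D).1 * n ^+ deleted X.2 (val D).2)%R)))) L)%N.
Proof.
move=> dimM trivM isoL.
pose f := table (V0_basis b r) (@type_functional F b r (stable_types b r)).
pose la s : 'M[F]_#|V0_basis b r| := monomial_mx (V0_basis b r)
  (fun X => (permute_north s X.1, permute_north s X.2)) (fun=> 1).
pose ra (D : diagram r r) := monomial_mx (V0_basis b r)
  (fun X => (stack X.1 D, stack X.2 D))
  (fun X => m ^+ deleted X.1 D * n ^+ deleted X.2 D).
have la_f h : la h *m f = f by apply: type_functional_north.
have ra_f D : ra D *m f = perm_char F D *: f.
  apply: type_functional_south => // t.
  by case/(stable_typesP r_gt0) => _ _ [].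
exact: (mult_tensor_ge la_f ra_f trivM isoL dimM type_functional_full).
Qed.

End RamifiedBound.

Lemma sumn_row_partition b : sumn (row_partition b) = b.
Proof. by rewrite /row_partition; case: eqP => [->|_] //=; rewrite addn0. Qed.

Lemma ramified_mult_ge (F : fieldType) (b r : nat) (m n delta : F) : (0 < r)%N ->
  (size (stable_types b r) <=
   mult (pull_rmod (@diag_ramified r r) (ramified_standard_module m n r (row_partition b)))
        (simple_head delta r (row_partition r)))%N.
Proof.
(* The module is built on [sumn (row_partition b)] northern vertices, so the count of types is put
   in the same form. *)
move=> r_gt0; rewrite -{1}(sumn_row_partition b).
have card_row c : #|'I_(sumn (row_partition c))| = c.
  by rewrite card_ord sumn_row_partition.
have [dimM trivM] := specht_row F (card_row b).
apply: ramified_tensor_mult_ge => //; apply: head_iso_char.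
have [dimN trivN] := specht_row F (card_row r).
by apply: standard_module_iso_char => //; apply: sumn_row_partition.
Qed.

(** * The bounds *)

Lemma pad_row_partition c d : c + c <= d -> pad_is_partition (row_partition c) d.
Proof.
move=> lecd; rewrite /pad_is_partition sumn_row_partition /row_partition.
by case: eqP => [_|_] /=; lia.
Qed.

Section Bounds.
Variables b r : nat.
Hypotheses (r_gt0 : 0 < r) (lt_br : b < r).

Let M := r - b + (1 <= b).

Lemma plethysm_row m n (k : int) : 0 < m -> r + r <= m * n -> b + b <= n ->
  plethysm_coef_is (pad (row_partition b) n) (row_partition m)
    (pad (row_partition r) (m * n)) k ->
  k = net (row_plethysm b m (n - b)) r.
Proof.
move=> m_gt0 le2r le2b.
have n_gt0 : 0 < n by rewrite lt0n; apply: contraTneq le2r => ->; rewrite muln0; lia.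
have rowE c : 0 < c -> row_partition c = [:: c] by case: c.
have padr : pad (row_partition r) (m * n) = [:: m * n - r; r].
  rewrite rowE // /pad /= addn0.
  have -> : m * n - r != 0 by lia.
  by have -> : r != 0 by lia.
have [nu0 nu1 sum_nu size_nu] : [/\ nth 0 (pad (row_partition b) n) 0 = n - b,
    nth 0 (pad (row_partition b) n) 1 = b, sumn (pad (row_partition b) n) = n
    & size (pad (row_partition b) n) <= 2].
  have [->|b_gt0] := posnP b.
    by rewrite /pad /= subn0; case: n n_gt0 {le2r le2b padr} => //= n _; rewrite addn0.
  rewrite rowE // /pad /= addn0.
  have -> : n - b != 0 by lia.
  have -> : b != 0 by lia.
  by split=> //=; lia.
rewrite padr (rowE m) // => coef_k.
have DN : m * n = sumn (pad (row_partition b) n) * sumn [:: m].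
  by rewrite sum_nu /= addn0 mulnC.
have := plethysm_coef_net m_gt0 DN r_gt0 le2r erefl size_nu _ _ coef_k.
by rewrite nu0 nu1; apply; lia.
Qed.

(** Both theorems reduce to one inequality: a sufficient condition keeps the coefficient from
    falling below its stable value, whereas it drops by one just outside either bound. *)
Lemma bounds_not_weakenable_of_value (claim : nat -> nat -> Prop) :
    (forall m0 n0, 0 < m0 -> 0 < n0 ->
       (forall m n, m0 <= m -> n0 <= n -> claim m n) ->
     forall m n, m0 <= m -> n0 <= n -> r + r <= m * n -> b + b <= n ->
     (stable_net b r M <= net (row_plethysm b m (n - b)) r)%R) ->
  bounds_not_weakenable claim M (r + b).
Proof.
move=> claim_ge m0 n0 m0_gt0 n0_gt0 /(claim_ge _ _ m0_gt0 n0_gt0){}claim_ge.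
split; rewrite leqNgt; apply/negP => lt.
  have [m Dm] : exists m, M = m.+1 by exists M.-1; lia.
  (* Here [m] is one below its bound, still positive because [0 < m0], and [n] is large enough for
     all side conditions. *)
  have {claim_ge} := claim_ge m (n0 + r + b + r + b).
  rewrite net_row_plethysm; last by lia.
  rewrite Dm stable_net_drop //.
  have : 0 < m by lia.
  move=> m_gt0; have le2r : r + r <= m * (n0 + r + b + r + b).
    by apply: leq_trans (leq_pmull _ m_gt0); lia.
  by move=> ge; have := ge ltac:(lia) ltac:(lia) le2r ltac:(lia); lia.
(* Now [n] is one below its bound, still at least [2b] because [b < r], and [m] lies in the stable
   range. *)
have ge := claim_ge (m0 + r + r) (r + b).-1.
have Dn : (r + b).-1 - b = r.-1 by lia.
rewrite Dn net_row_plethysm_pred // in ge; last by lia.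
rewrite (stable_net_const (m := m0 + r + r)) // -/M in ge; last by lia.
have le2r : r + r <= (m0 + r + r) * (r + b).-1.
  have [r1|r1] := leqP (r + b) 1; first lia.
  by apply: leq_trans (leq_pmulr _ _); lia.
by have := ge ltac:(lia) ltac:(lia) le2r ltac:(lia); lia.
Qed.

End Bounds.

(** Applying the claim at one pair beyond both bounds identifies [stable_value] with the stable
    coefficient; being independent of [m] and [n], it is then the coefficient at every pair covered
    by the claim. *)
Lemma claimA_bounds (F : fieldType) b r : 0 < r -> b < r ->
  bounds_not_weakenable (claimA F (row_partition b) (row_partition r))
    (r - b + (1 <= b)) (r + b).
Proof.
move=> r_gt0 lt_br; apply: bounds_not_weakenable_of_value => // m0 n0 m0_gt0 n0_gt0 claim.
have value m n : m0 <= m -> n0 <= n -> r + r <= m * n -> b + b <= n ->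
    Posz (stable_value F (row_partition b) (row_partition r)) = net (row_plethysm b m (n - b)) r.
  move=> lem len le2r le2b; apply: plethysm_row => //; first exact: leq_trans lem.
  by apply: claim => //; apply: pad_row_partition.
move=> m n lem len le2r le2b; rewrite -value //.
have le2r' : r + r <= (m0 + r + r) * (n0 + r + b + b).
  by apply: (@leq_trans (m0 + r + r)); [lia | apply: leq_pmulr; lia].
have -> := value (m0 + r + r) (n0 + r + b + b) ltac:(lia) ltac:(lia) le2r' ltac:(lia).
rewrite net_row_plethysm; last by lia.
by rewrite stable_net_const //; lia.
Qed.

Lemma claimC_bounds (F : fieldType) b r : 0 < r -> b < r ->
  bounds_not_weakenable (claimC F (row_partition b) (row_partition r) r)
    (r - b + (1 <= b)) (r + b).
Proof.
move=> r_gt0 lt_br; apply: bounds_not_weakenable_of_value => // m0 n0 m0_gt0 n0_gt0 claim.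
move=> m n lem len le2r le2b.
have := claim m n lem len; rewrite /claimC sumn_row_partition.
move=> /(_ (leqnn r) (pad_row_partition le2b) (pad_row_partition le2r)).
move=> /plethysm_row <- //; last exact: leq_trans lem.
(* The bound on [m] is at most [r], so the stable value may be taken at [m = r], where it counts the
   types. *)
rewrite -(stable_net_const r_gt0 (m := r)); last by lia.
by rewrite -size_stable_types // lez_nat ramified_mult_ge.
Qed.

Theorem corollary11p4 (R : realType) (b r : nat) (hr : 0 < r) (hbr : b < r) :
  bounds_not_weakenable
    (claimA R[i] (row_partition b) (row_partition r))
    (r - b + (1 <= b)) (r + b)
  /\
  bounds_not_weakenable
    (claimC R[i] (row_partition b) (row_partition r) r)
    (r - b + (1 <= b)) (r + b).
Proof. by split; [apply: claimA_bounds | apply: claimC_bounds]. Qed.
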